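(* Let $\Omega\subset\mathbb R^n$ be a bounded domain satisfying the uniform exterior ball condition. Let $0<\sigma<2$, let $g$ be a bounded continuous function on $\mathbb R^n$, and let $I$ be a nonlocal operator on $\Omega$ that is uniformly elliptic (of order $\sigma$) and has the properties Continuity and Monotonicity of the context. Assume that $x\mapsto I(x,0,0)$ is bounded in $\Omega$. Then the Dirichlet problem $$I(x,u(x),u(\cdot))=0\ \text{ in }\Omega,\qquad u=g\ \text{ in }\Omega^c$$ admits a continuous viscosity supersolution $\bar u$ and a continuous viscosity subsolution $\underline u$ with $\bar u=\underline u=g$ in $\Omega^c$.
   Context: $B_\delta(x)$ is the open ball, $B_\delta=B_\delta(0)$. $C^2(U)$ denotes $C^{1,1}(U)$ (first partial derivatives locally Lipschitz); $C_b^2(\mathbb R^n)$ is the set of bounded such functions on $\mathbb R^n$. Uniform exterior ball condition: there is $r_\Omega>0$ such that for any $x\in\partial\Omega$ and $0<r\le r_\Omega$ there exists $y_x^r\in\Omega^c$ with $\bar B_r(y_x^r)\cap\bar\Omega=\{x\}$. A nonlocal operator $I$ on $\Omega$ assigns a real number $I(x,r,\varphi(\cdot))$ to each $x\in\Omega$, $r\in\mathbb R$, $\varphi\in C^2(B_\delta(x))\cap L^\infty(\mathbb R^n)$ ($\delta>0$). $I(x,0,0)$ is the value at $r=0$ and the zero function. - Continuity: for every $\delta>0$, $x\in\Omega$ and $\varphi\in C^2(B_\delta(x))\cap L^\infty(\mathbb R^n)$, $(y,r)\mapsto I(y,r,\varphi(\cdot))$ is continuous on $(B_\delta(x)\cap\Omega)\times\mathbb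 R$. - Monotonicity: $r\le s$ implies $I(x,r,\varphi(\cdot))\le I(x,s,\varphi(\cdot))$. Kernel class. For $0<\sigma<2$, $\delta_zu(x)$ equals $u(x+z)-u(x)$ if $\sigma<1$; $u(x+z)-u(x)-\mathbf 1_{B_1}(z)\nabla u(x)\cdot z$ if $\sigma=1$; $u(x+z)-u(x)-\nabla u(x)\cdot z$ if $\sigma>1$. Given $0<\lambda\le\Lambda$, $\mu>0$, $\mathcal L$ is the class of operators $Lu(x)=\int_{\mathbb R^n}\delta_zu(x)K(z)\,dz$ with (measurable) $K\ge0$ such that for every $\delta>0$: $\int_{B_{2\delta}\setminus B_\delta}K\,dz\le(2-\sigma)\Lambda\delta^{-\sigma}$; $|\int_{B_{2\delta}\setminus B_\delta}zK(z)\,dz|\le\Lambda|1-\sigma|\delta^{1-\sigma}$; and there is $A_\delta\subset B_{2\delta}\setminus B_\delta$ with $A_\delta=-A_\delta$, $|A_\delta|\ge\mu|B_{2\delta}\setminus B_\delta|$, $K(z)\ge(2-\sigma)\lambda\delta^{-n-\sigma}$ on $A_\delta$. $M^+_{\mathcal L}u=\sup_{L\in\mathcal L}Lu$, $M^-_{\mathcal L}u=\inf_{L\in\mathcal L}Lu$. $I$ is uniformly elliptic if there are such $\lambda,\Lambda,\mu$, a modulus of continuity $m:[0,\infty)\to[0,\infty)$ (nondecreasing, $m(0)=0$, continuous at $0$) and $C_0\ge0$, with $C_0=0$ if $\sigma<1$, such that for all $r,s\in\mathbb R$, $x\in\Omega$, $\delta>0$, $\varphi,\psi\in C^2(B_\delta(x))\cap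 L^\infty(\mathbb R^n)$, $$M^-_{\mathcal L}(\varphi-\psi)(x)-C_0|\nabla(\psi-\varphi)(x)|-m(|r-s|)\le I(x,r,\psi(\cdot))-I(x,s,\varphi(\cdot))\le M^+_{\mathcal L}(\varphi-\psi)(x)+C_0|\nabla(\psi-\varphi)(x)|+m(|r-s|).$$ A bounded upper semicontinuous $u$ on $\mathbb R^n$ is a viscosity subsolution of $I=0$ in $\Omega$ if whenever $u-\varphi$ has a maximum over $\mathbb R^n$ at $x\in\Omega$, $\varphi\in C_b^2(\mathbb R^n)$, then $I(x,u(x),\varphi(\cdot))\le0$; a bounded lower semicontinuous $u$ is a viscosity supersolution if whenever $u-\varphi$ has a minimum over $\mathbb R^n$ at $x\in\Omega$, $\varphi\in C_b^2(\mathbb R^n)$, then $I(x,u(x),\varphi(\cdot))\ge0$. A viscosity subsolution (supersolution) of the Dirichlet problem is one of $I=0$ in $\Omega$ that is moreover $\le g$ ($\ge g$) in $\Omega^c$. *)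

(* Defs.v *)
From HB Require Import structures.
From mathcomp Require Import all_boot all_order all_algebra.
From mathcomp Require Import all_classical all_reals all_analysis.

Set Implicit Arguments.
Unset Strict Implicit.
Unset Printing Implicit Defensive.

Import Order.TTheory GRing.Theory Num.Theory.
Import numFieldNormedType.Exports.

Local Open Scope classical_set_scope.
Local Open Scope ring_scope.

(* The ambient space is 'rV[R]_n.+1, i.e. Euclidean space of dimension
   n.+1 >= 1.  The library's norm on row vectors is the sup norm: it is used
   below only for notions that do not depend on the choice of a norm
   (topology, boundedness, local Lipschitz continuity). *)

Section Euclidean.
Context {R : realType} {n : nat}.
Implicit Types (x z : 'rV[R]_n.+1) (p : 'rV[R]_n.+1 * 'rV[R]_n.+1).

Definition dotv x z : R := \sum_i x 0 i * z 0 i.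

Definition enorm x : R := Num.sqrt (\sum_i x 0 i ^+ 2).

Definition eball x (r : R) : set 'rV[R]_n.+1 := [set y | enorm (y - x) < r].

Definition eclosed_ball x (r : R) : set 'rV[R]_n.+1 :=
  [set y | enorm (y - x) <= r].

Definition annulus (r : R) : set 'rV[R]_n.+1 := eball 0 (2 * r) `\` eball 0 r.

Definition box p : set 'rV[R]_n.+1 :=
  [set x | forall i, p.1 0 i <= x 0 i <= p.2 0 i].

Definition box_volume p : R := \prod_i Num.max 0 (p.2 0 i - p.1 0 i).

Definition lebesgue_outer (A : set 'rV[R]_n.+1) : \bar R :=
  ereal_inf [set (\sum_(k <oo) (box_volume (p k))%:E)%E |
    p in [set p : nat -> 'rV[R]_n.+1 * 'rV[R]_n.+1 |
          A `<=` \bigcup_k box (p k)]].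

Lemma box_volume_ge0 p : 0 <= box_volume p.
Proof. by apply: prodr_ge0 => i _; rewrite le_max lexx. Qed.

Let volE_ge0 p : (0 <= (box_volume p)%:E)%E.
Proof. by rewrite lee_fin box_volume_ge0. Qed.

Lemma lebesgue_outer_ge0 A : (0 <= lebesgue_outer A)%E.
Proof. by apply: le_ereal_inf_tmp => _ [p _ <-]; exact: nneseries_ge0. Qed.

Lemma lebesgue_outer0 : lebesgue_outer set0 = 0%E.
Proof.
apply/eqP; rewrite eq_le lebesgue_outer_ge0 andbT.
apply: ereal_inf_lbound => /=; exists (fun=> (0, 0)); first by [].
rewrite eseries0// => k _ _; congr EFin.
by rewrite /box_volume big_ord_recl /= subrr maxxx mul0r.
Qed.

Lemma le_lebesgue_outer : {homo lebesgue_outer : A B / A `<=` B >-> (A <= B)%E}.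
Proof.
move=> A B AB; apply/ereal_inf_le_tmp => _ [p pB <-].
by exists p => //; apply: subset_trans AB pB.
Qed.

Lemma lebesgue_outer_sigma_subadditive : sigma_subadditive lebesgue_outer.
Proof.
move=> A; have [[i ioo]|] := pselect (exists i, lebesgue_outer (A i) = +oo%E).
  rewrite (eseries_pinfty _ _ ioo) ?leey// => k _.
  by rewrite -ltNye (lt_le_trans _ (lebesgue_outer_ge0 _)).
rewrite -forallNE => Aoo.
apply/lee_addgt0Pr => _/posnumP[e].
rewrite (le_trans _ (epsilon_trick _ _ _))//; last first.
  by move=> k; exact: lebesgue_outer_ge0.
pose P k (p : nat -> 'rV[R]_n.+1 * 'rV[R]_n.+1) :=
  A k `<=` \bigcup_j box (p j) /\
  (\sum_(j <oo) (box_volume (p j))%:E <=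
     lebesgue_outer (A k) + (e%:num / (2 ^ k.+1)%:R)%:E)%E.
have [G PG] : {G & forall k, P k (G k)}.
  apply: (@choice _ _ P) => k; rewrite /P.
  have Afin : lebesgue_outer (A k) \is a fin_num.
    by rewrite ge0_fin_numE ?lebesgue_outer_ge0// ltey; exact/eqP/Aoo.
  have ek : 0 < e%:num / (2 ^ k.+1)%:R by [].
  have [_ [p pA <-] plt] := lb_ereal_inf_adherent ek Afin.
  by exists p; split => //; exact/ltW.
pose v (ij : nat * nat) := (box_volume (G ij.1 ij.2))%:E.
have v_ge0 ij : (0 <= v ij)%E by exact: volE_ge0.
apply: (@le_trans _ _ (\esum_(i in setT) v i)%E).
  apply: ereal_inf_lbound => /=.
  have /card_esym/ppcard_eqP[f] := card_nat2.
  exists (fun k => G (f k).1 (f k).2).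
    move=> t [i _ /(PG i).1[j _ Gijt]].
    by exists (f^-1%FUN (i, j)) => //; rewrite invK ?inE.
  rewrite -(esum_pred_image v f xpredT) ?[fun=> _]set_true//.
  by rewrite image_eq.
rewrite (_ : esum _ _ =
    \sum_(i <oo) \sum_(j <oo) (box_volume (G i j))%:E)%E; last first.
  pose J : nat -> set (nat * nat) := fun i => [set (i, j) | j in setT].
  rewrite (_ : setT = \bigcup_k J k); last first.
    by rewrite predeqE => -[a b]; split => // _; exists a => //; exists b.
  rewrite esum_bigcupT //=; last first.
    apply/trivIsetP => i j _ _ ij.
    rewrite predeqE => -[a b] /=; split => //= -[] [_] _ [<-{a} _].
    by move=> [b' _] [] /esym/eqP; rewrite (negbTE ij).
  rewrite -(image_id [set: nat]) -fun_true esum_pred_image//; last first.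
    by move=> k _; exact: esum_ge0.
  apply: eq_eseriesr => /= j _.
  rewrite -(esum_pred_image v (pair j) predT)//=; last first.
    by move=> ? ? _ _; exact: (@can_inj _ _ _ snd).
  by congr esum; rewrite predeqE => -[a b]; split; move=> [i _ <-]; exists i.
apply: lee_lim.
- by apply: is_cvg_nneseries => k *; exact: nneseries_ge0.
- apply: is_cvg_nneseries => k *.
  by apply: adde_ge0 => //; exact: lebesgue_outer_ge0.
- by near=> k; apply: lee_sum => i _; exact: (PG i).2.
Unshelve. all: by end_near. Qed.

HB.instance Definition _ := isOuterMeasure.Build R 'rV[R]_n.+1 lebesgue_outer
  lebesgue_outer0 lebesgue_outer_ge0 le_lebesgue_outer
  lebesgue_outer_sigma_subadditive.

End Euclidean.

Arguments lebesgue_outer R n A : clear implicits.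

(* The Caratheodory sigma-algebra of the outer measure given by countable box
   covers is that of the Lebesgue measurable sets: measurability of kernels
   and of L^oo functions below is Lebesgue measurability. *)
Definition Rn (R : realType) (n : nat) := caratheodory_type (lebesgue_outer R n).
HB.instance Definition _ (R : realType) (n : nat) := Measurable.on (Rn R n).
Definition lebesgueRn (R : realType) (n : nat) : set (Rn R n) -> \bar R :=
  lebesgue_outer R n.
Arguments lebesgueRn R n A : clear implicits.
HB.instance Definition _ (R : realType) (n : nat) :=
  isMeasure.Build _ (Rn R n) R (lebesgueRn R n)
    (@caratheodory_measure0 _ _ (lebesgue_outer R n))
    (@caratheodory_measure_ge0 _ _ (lebesgue_outer R n))
    (@caratheodory_measure_sigma_additive _ _ (lebesgue_outer R n)).

Section NonlocalOperators.
Context {R : realType} {n : nat}.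
Local Notation E := 'rV[R]_n.+1.
Implicit Types (x z : E) (u phi psi : E -> R) (Omega U : set E) (sigma : R).

Definition partial u (i : 'I_n.+1) : E -> R := 'D_('e_i) u.

Definition grad u x : E := \row_i partial u i x.

(* C^{1,1} regularity, written C^2 as in the literature on viscosity solutions
   of nonlocal equations; only used for U open. *)
Definition C2 U u := forall i : 'I_n.+1,
  (forall x, U x -> derivable u x 'e_i) /\
  (forall x, U x ->
     exists2 V, nbhs x V & [lipschitz partial u i y | y in V]).

Definition Linfty u :=
  measurable_fun setT (u : Rn R n -> R) /\
  exists M : R, {ae lebesgueRn R n, forall x, `|u x| <= M}.

Definition C2b phi := C2 setT phi /\ bounded_fun phi.

Definition domain Omega := [/\ open Omega, connected Omega & Omega !=set0].

Definition uniform_exterior_ball Omega := exists2 rOmega : R, 0 < rOmega &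
  forall x, (closure Omega `\` Omega°) x ->
  forall r : R, 0 < r <= rOmega ->
  exists2 y, (~` Omega) y & eclosed_ball y r `&` closure Omega = [set x].

Definition increment sigma u x z : R :=
  if sigma < 1 then u (x + z) - u x
  else if sigma == 1 then
    u (x + z) - u x - \1_(eball 0 1) z * dotv (grad u x) z
  else u (x + z) - u x - dotv (grad u x) z.

Definition linear_operator sigma (K : E -> R) u x : \bar R :=
  (\int[lebesgueRn R n]_z (increment sigma u x z * K z)%:E)%E.

Definition kernel_class sigma (lambda Lambda mu : R) : set (E -> R) :=
  [set K | [/\ measurable_fun setT (K : Rn R n -> R),
               forall z, 0 <= K z
             & forall delta : R, 0 < delta ->
    [/\ (\int[lebesgueRn R n]_(z in annulus delta) (K z)%:E <=
           ((2 - sigma) * Lambda * delta `^ (- sigma))%:E)%E,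
        enorm (\row_i (\int[lebesgueRn R n]_(z in annulus delta)
                          ((z : E) 0 i * K z))) <=
          Lambda * `|1 - sigma| * delta `^ (1 - sigma)
      & exists A : set (Rn R n),
          [/\ measurable A,
              A `<=` annulus delta,
              A = [set - z | z in (A : set E)],
              (mu%:E * lebesgueRn R n (annulus delta) <= lebesgueRn R n A)%E
            & forall z, A z ->
                (2 - sigma) * lambda * delta `^ (- n.+1%:R - sigma) <= K z]]]].

Definition Mplus sigma (lambda Lambda mu : R) u x : \bar R :=
  ereal_sup [set linear_operator sigma K u x |
             K in kernel_class sigma lambda Lambda mu].

Definition Mminus sigma (lambda Lambda mu : R) u x : \bar R :=
  ereal_inf [set linear_operator sigma K u x |
             K in kernel_class sigma lambda Lambda mu].

(* A nonlocal operator on Omega is represented by a total function I; only its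
   values I x r phi with x in Omega and [admissible delta x phi] for some
   delta > 0 are meaningful, and only these are constrained below. *)
Implicit Type I : E -> R -> (E -> R) -> R.

Definition admissible (delta : R) x phi := C2 (eball x delta) phi /\ Linfty phi.

Definition operator_continuity Omega I := forall (delta : R) x phi,
  0 < delta -> Omega x -> admissible delta x phi ->
  {within (eball x delta `&` Omega) `*` setT,
    continuous (fun yr : E * R => I yr.1 yr.2 phi)}.

Definition operator_monotonicity Omega I := forall (delta : R) x phi (r s : R),
  0 < delta -> Omega x -> admissible delta x phi ->
  r <= s -> I x r phi <= I x s phi.

Definition modulus_of_continuity (m : R -> R) :=
  [/\ forall t : R, 0 <= t -> 0 <= m t,
      forall s t : R, 0 <= s -> s <= t -> m s <= m t,
      m 0 = 0
    & m t @[t --> 0^'+] --> (0 : R)].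

Definition uniformly_elliptic sigma Omega I :=
  exists (lambda Lambda mu : R) (m : R -> R) (C0 : R),
  [/\ [/\ 0 < lambda, lambda <= Lambda & 0 < mu],
      modulus_of_continuity m,
      0 <= C0,
      (sigma < 1 -> C0 = 0)
    & forall (r s : R) x (delta : R) phi psi,
        Omega x -> 0 < delta -> admissible delta x phi ->
        admissible delta x psi ->
        let err := C0 * enorm (grad (psi \- phi) x) + m `|r - s| in
        (Mminus sigma lambda Lambda mu (phi \- psi)%R x - err%:E <=
           (I x r psi - I x s phi)%:E <=
         Mplus sigma lambda Lambda mu (phi \- psi)%R x + err%:E)%E].

Definition lsc u := lower_semicontinuous (EFin \o u).
Definition usc u := lower_semicontinuous (EFin \o (\- u)).

Definition viscosity_subsolution Omega I u :=
  [/\ bounded_fun u, usc u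
    & forall x phi, Omega x -> C2b phi ->
        (forall y, u y - phi y <= u x - phi x) -> I x (u x) phi <= 0].

Definition viscosity_supersolution Omega I u :=
  [/\ bounded_fun u, lsc u
    & forall x phi, Omega x -> C2b phi ->
        (forall y, u x - phi x <= u y - phi y) -> 0 <= I x (u x) phi].

Definition Dirichlet_subsolution Omega I (g : E -> R) u :=
  viscosity_subsolution Omega I u /\ forall x, (~` Omega) x -> u x <= g x.

Definition Dirichlet_supersolution Omega I (g : E -> R) u :=
  viscosity_supersolution Omega I u /\ forall x, (~` Omega) x -> g x <= u x.

End NonlocalOperators.

(* Main.v *)
Require Import Defs.
From mathcomp Require Import all_boot all_order all_algebra.
From mathcomp Require Import all_classical all_reals all_analysis.
From mathcomp Require Import measurable_realfun ring lra.
Import Order.TTheory GRing.Theory Num.Theory.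
Import numFieldNormedType.Exports.
Local Open Scope classical_set_scope.
Local Open Scope ring_scope.

(** By ellipticity and monotonicity it suffices to find a continuous [u >= g],
    equal to [g] off [Omega], such that every test function [phi] touching [u]
    from below at a point of [Omega] satisfies
    [L phi + C0 |grad phi| <= - C1] for all kernels, with [C1] large; the
    subsolution is then [- u] for the datum [- g].

    For each scale [k], let [y] range over the centers of balls of radius [r_k]
    that miss [Omega], and let
    [f_{k,y}(x) = g y + 2 eps_k + al_k ln (1 + (|x - y| - r_k)^+ / tau_k)],
    where [g] oscillates by at most [eps_k] on balls of radius [2 r_k].  In
    [Omega], [u] is the infimum of a large constant [M] and of all [f_{k,y}]; it
    is attained because near a given point only finitely many [k] matter and the
    centers form a compact set.  At distance [d] from the ball, a function
    touching [f_{k,y}] sees an increment at most [- eps_k] inside the ball, which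
    by the symmetric lower bound on the kernels contributes [- c eps_k d^-sigma],
    while the logarithm contributes at most [C al_k d^-sigma] by dyadic
    summation.  Taking [al_k] much smaller than [eps_k], then [d] small, and
    finally [tau_k] so small that [f_{k,y} >= M] for larger [d], gives the
    estimate.  Where [u = M], [phi] has a global maximum, and the drop to [g]
    outside [Omega] suffices. *)

(** * Euclidean inner product and norm, compared with the sup norm *)

Section EuclideanNorm.
Context {R : realType} {n : nat}.
Implicit Types (x y z e : 'rV[R]_n.+1) (a b : R).

(** The logarithm is chosen for its scaling. At distance [d] from the ball its increments are
    controlled by [|z| / d], uniformly in [tau], while the height reached at a fixed distance is
    unbounded as [tau] tends to 0. The gain from the ball is a half-space effect. The kernels are
    bounded below only on an unknown symmetric set, but up to a thin slab half of it lies in any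
    given half-space, and inside an annulus of radius comparable to [d] the ball contains a
    half-space cut at depth comparable to [d]. At [sigma = 1], bounding the gradient term between
    [|z| = d] and [|z| = 1] by absolute values would cost a factor [ln (1 / d)]; it is removed
    exactly by the vanishing first moments on dyadic annuli. Integrals of test functions are never
    shown to be finite. They are compared with integrable majorants, and the bounds for [phi] and
    for [- phi] are carried separately. The cap [M] depends on [C1], so [C1] must not depend on the
    size of [u]; monotonicity of the operator breaks this circle. *)

Lemma dotvC x y : dotv x y = dotv y x.
Proof. by apply: eq_bigr => i _; rewrite mulrC. Qed.

Lemma dotvDl x y z : dotv (x + y) z = dotv x z + dotv y z.
Proof.
by rewrite /dotv -big_split; apply: eq_bigr => i _; rewrite /= mxE mulrDl.
Qed.

Lemma dotvDr x y z : dotv x (y + z) = dotv x y + dotv x z.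
Proof. by rewrite dotvC dotvDl !(dotvC x). Qed.

Lemma dotvZl a x y : dotv (a *: x) y = a * dotv x y.
Proof. by rewrite /dotv mulr_sumr; apply: eq_bigr => i _; rewrite mxE mulrA. Qed.

Lemma dotvZr a x y : dotv x (a *: y) = a * dotv x y.
Proof. by rewrite dotvC dotvZl dotvC. Qed.

Lemma dotvNl x y : dotv (- x) y = - dotv x y.
Proof. by rewrite -scaleN1r dotvZl mulN1r. Qed.

Lemma dotvNr x y : dotv x (- y) = - dotv x y.
Proof. by rewrite dotvC dotvNl dotvC. Qed.

Lemma dotv0r x : dotv x 0 = 0.
Proof. by rewrite /dotv big1 // => i _; rewrite mxE mulr0. Qed.

Lemma dotv_self_ge0 x : 0 <= dotv x x.
Proof. by apply: sumr_ge0 => i _; rewrite -expr2 sqr_ge0. Qed.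

Lemma enorm_ge0 x : 0 <= enorm x.
Proof. exact: sqrtr_ge0. Qed.

Lemma sqr_enorm x : enorm x ^+ 2 = dotv x x.
Proof.
rewrite sqr_sqrtr; last by apply: sumr_ge0 => i _; exact: sqr_ge0.
by apply: eq_bigr => i _; rewrite expr2.
Qed.

Lemma enorm0 : enorm (0 : 'rV[R]_n.+1) = 0.
Proof. by apply/eqP; rewrite -sqrf_eq0 sqr_enorm dotv0r. Qed.

Lemma enorm_le x a : 0 <= a -> dotv x x <= a ^+ 2 -> enorm x <= a.
Proof. by move=> a0; rewrite -sqr_enorm ler_sqr // nnegrE enorm_ge0. Qed.

Lemma enormN x : enorm (- x) = enorm x.
Proof. by congr Num.sqrt; apply: eq_bigr => i _; rewrite mxE sqrrN. Qed.

Lemma enormZ a x : enorm (a *: x) = `|a| * enorm x.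
Proof.
apply/eqP; rewrite -(eqrXn2 (n := 2)) ?enorm_ge0 ?mulr_ge0 ?enorm_ge0 //.
by rewrite exprMn !sqr_enorm dotvZl dotvZr mulrA -expr2 real_normK ?num_real.
Qed.

Lemma sqr_enormD x y :
  enorm (x + y) ^+ 2 = enorm x ^+ 2 + 2 * dotv x y + enorm y ^+ 2.
Proof. rewrite !sqr_enorm dotvDl !dotvDr (dotvC y x); ring. Qed.

Lemma enorm_eq0 x : enorm x = 0 -> x = 0.
Proof.
move=> x0; apply/rowP => i; rewrite mxE; apply/eqP; rewrite -sqrf_eq0.
have := sqr_enorm x; rewrite x0 expr0n /= => /esym/eqP.
rewrite psumr_eq0 => [/allP/(_ i (mem_index_enum i))|j _]; last first.
  by rewrite -expr2 sqr_ge0.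
by rewrite -expr2.
Qed.

Lemma dotv_delta x (i : 'I_n.+1) : dotv x 'e_i = x 0 i.
Proof.
rewrite /dotv (bigD1 i) //= !mxE !eqxx mulr1 big1 ?addr0 // => j ji.
by rewrite !mxE /= (negbTE ji) mulr0.
Qed.

(** Cauchy-Schwarz, by expanding the square of [enorm y *: x - enorm x *: y], which equals
    [2 |x| |y| (|x| |y| - x.y)]. *)
Lemma dotv_le x y : dotv x y <= enorm x * enorm y.
Proof.
have [x0|x0] := eqVneq (enorm x) 0.
  by rewrite (enorm_eq0 x x0) dotvC dotv0r enorm0 mul0r.
have xp : 0 < enorm x by rewrite lt0r x0 enorm_ge0.
have := dotv_self_ge0 (enorm y *: x - enorm x *: y).
rewrite dotvDl !dotvDr !dotvNl !dotvNr !dotvZl !dotvZr -!sqr_enorm (dotvC y x).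
have [y0|y0] := eqVneq (enorm y) 0.
  move=> _; rewrite y0 mulr0.
  by rewrite (enorm_eq0 y y0) dotv0r.
have yp : 0 < enorm y by rewrite lt0r y0 enorm_ge0.
move=> h; rewrite -(ler_pM2l (mulr_gt0 xp yp)).
move: (enorm x) (enorm y) (dotv x y) h => a b c; nra.
Qed.

Lemma dotv_ge x y : - (enorm x * enorm y) <= dotv x y.
Proof. by rewrite lerNl -dotvNl -(enormN x) dotv_le. Qed.

Lemma enormD x y : enorm (x + y) <= enorm x + enorm y.
Proof.
apply: enorm_le; first by rewrite addr_ge0 ?enorm_ge0.
rewrite -sqr_enorm sqr_enormD; have := dotv_le x y; lra.
Qed.

Lemma enorm_distC x y : enorm (x - y) = enorm (y - x).
Proof. by rewrite -enormN opprB. Qed.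

Lemma enorm_subl x y : enorm x - enorm y <= enorm (x - y).
Proof. by rewrite lerBlDr (le_trans _ (enormD _ _)) // subrK. Qed.

Lemma enormBD x y z : enorm (x - z) <= enorm (x - y) + enorm (y - z).
Proof. by rewrite (le_trans _ (enormD _ _)) // addrA subrK. Qed.

Lemma coord_le_enorm x i : `|x 0 i| <= enorm x.
Proof.
rewrite -sqrtr_sqr ler_wsqrtr // (bigD1 i) //= lerDl.
by apply: sumr_ge0 => j _; exact: sqr_ge0.
Qed.

Lemma norm_le_enorm x : `|x| <= enorm x.
Proof.
rewrite [`|x|]mx_normrE; apply/bigmax_leP; split=> [|[i j] _ /=].
  exact: enorm_ge0.
by rewrite ord1 coord_le_enorm.
Qed.

Lemma coord_le_norm x i : `|x 0 i| <= `|x|.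
Proof. by rewrite [leRHS]mx_normrE; apply: (le_bigmax _ _ (0, i)). Qed.

Lemma enorm_le_norm x : enorm x <= n.+1%:R * `|x|.
Proof.
apply: enorm_le; first by rewrite mulr_ge0.
apply: (@le_trans _ _ (\sum_(i < n.+1) `|x| ^+ 2)).
  apply: ler_sum => i _; rewrite -expr2 -real_normK ?num_real //.
  by rewrite lerXn2r ?nnegrE // coord_le_norm.
rewrite sumr_const card_ord exprMn -[leLHS]mulr_natl ler_wpM2r ?sqr_ge0 //.
by rewrite expr2 ler_peMr // ler1n.
Qed.

End EuclideanNorm.

(** * Behavior of the outer measure under translations, reflection and dilations *)

Section OuterMeasureTransformations.
Context {R : realType} {n : nat}.
Local Notation E := 'rV[R]_n.+1.
Implicit Types (A : set E) (a z : E) (c : R).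

(** Box covers of [A] are carried by [f] to box covers of the image. An inequality is enough:
    applied to a map and to its inverse, it gives equality for translations, the reflection and
    dilations. *)
Lemma lebesgue_outer_image_le (T : E -> E) (f : E * E -> E * E) (c : R) A :
  0 < c -> (forall p z, box p z -> box (f p) (T z)) ->
  (forall p, box_volume (f p) = c * box_volume p) ->
  (lebesgue_outer R n (T @` A) <= c%:E * lebesgue_outer R n A)%E.
Proof.
move=> c0 fT fv; rewrite -lee_pdivrMl //; apply: le_ereal_inf_tmp => _ [p pA <-].
rewrite lee_pdivrMl // -nneseriesZl; last first.
  by move=> i _; rewrite lee_fin box_volume_ge0.
apply: ereal_inf_lbound => /=; exists (f \o p).
  by move=> _ [z /pA [k _ pz] <-]; exists k => //; exact: fT.
by apply: eq_eseriesr => k _; rewrite /= fv EFinM.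
Qed.

Lemma lebesgue_outer_translate a A :
  lebesgue_outer R n [set a + z | z in A] = lebesgue_outer R n A.
Proof.
have le (b : E) (B : set E) : (lebesgue_outer R n [set (b + z)%R | z in B] <= lebesgue_outer R n B)%E.
  rewrite -[leRHS]mul1e.
  apply: (@lebesgue_outer_image_le (+%R b) (fun p => (b + p.1, b + p.2))) => //.
    by move=> p z pz i; rewrite !mxE !lerD2l.
  by move=> p; rewrite mul1r; apply: eq_bigr => i _; rewrite !mxE /=; congr Num.max; lra.
apply/eqP; rewrite eq_le le /=.
rewrite [X in (lebesgue_outer R n X <= _)%E](_ : A = [set - a + z | z in [set a + z | z in A]]%R) ?le //.
rewrite image_comp; apply/seteqP; split=> [z Az|_ [z Az <-] /=].
  by exists z => //=; rewrite addKr.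
by rewrite addKr.
Qed.

Lemma lebesgue_outer_opp A :
  lebesgue_outer R n [set - z | z in A] = lebesgue_outer R n A.
Proof.
have le (B : set E) : (lebesgue_outer R n [set (- z)%R | z in B] <= lebesgue_outer R n B)%E.
  rewrite -[leRHS]mul1e.
  apply: (@lebesgue_outer_image_le -%R (fun p => (- p.2, - p.1))) => //.
    by move=> p z pz i; rewrite !mxE !lerN2 andbC.
  by move=> p; rewrite mul1r; apply: eq_bigr => i _; rewrite !mxE /=; congr Num.max; lra.
apply/eqP; rewrite eq_le le /=.
rewrite [X in (lebesgue_outer R n X <= _)%E](_ : A = [set - z | z in [set - z | z in A]]%R) ?le //.
rewrite image_comp; apply/seteqP; split=> [z Az|_ [z Az <-] /=].
  by exists z => //=; rewrite opprK.
by rewrite opprK.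
Qed.

Lemma lebesgue_outer_scale c A : 0 < c ->
  lebesgue_outer R n [set c *: z | z in A] =
  ((c ^+ n.+1)%:E * lebesgue_outer R n A)%E.
Proof.
move=> c0.
have le (b : R) (B : set E) : 0 < b -> (lebesgue_outer R n [set (b *: z)%R | z in B] <=
    (b ^+ n.+1)%:E * lebesgue_outer R n B)%E.
  move=> b0; apply: (@lebesgue_outer_image_le _ (fun p => (b *: p.1, b *: p.2))).
  - by rewrite exprn_gt0.
  - by move=> p z pz i; rewrite !mxE !ler_pM2l.
  - move=> p; rewrite /box_volume (_ : b ^+ n.+1 = \prod_(i < n.+1) b); last first.
      by rewrite prodr_const card_ord.
    rewrite -big_split; apply: eq_bigr => i _; rewrite !mxE /= maxr_pMr ?ltW // mulr0.
    by rewrite mulrBr.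
apply/eqP; rewrite eq_le le //=.
rewrite -lee_pdivlMl ?exprn_gt0 // -exprVn.
rewrite [X in (lebesgue_outer R n X <= _)%E](_ : A = [set c^-1 *: z | z in [set c *: z | z in A]]).
  by rewrite le // invr_gt0.
rewrite image_comp; apply/seteqP; split=> [z Az|_ [z Az <-] /=].
  by exists z => //=; rewrite scalerK // gt_eqF.
by rewrite scalerK // gt_eqF.
Qed.

End OuterMeasureTransformations.

(* Induction on the dimension: the coefficients c keep track of the lengths of
   the sides already integrated out. *)
Lemma cube_cover_volume (R : realType) (m : nat) :
  forall (c : nat -> R) (a b : nat -> 'I_m -> R), (forall k, 0 <= c k) ->
  (forall x : 'I_m -> R, (forall i, 0 <= x i <= 1) ->
     exists k, 1 <= c k /\ forall i, a k i <= x i <= b k i) ->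
  (1 <= \sum_(k <oo) (c k * \prod_i Num.max 0 (b k i - a k i))%:E)%E.
Proof.
elim: m => [|m IH] c a b c0 cov.
  have [|k [ck _]] := cov (fun=> 0); first by case.
  rewrite (@nneseriesD1 _ _ k xpredT) //; last first.
    by move=> i _; rewrite lee_fin big_ord0 mulr1.
  rewrite big_ord0 mulr1 -[1%E]adde0 leeD ?lee_fin //.
  by apply: nneseries_ge0 => i _ _; rewrite lee_fin big_ord0 mulr1.
pose v k : R := \prod_(i < m) Num.max 0 (b k (lift ord0 i) - a k (lift ord0 i)).
have v0 k : 0 <= v k by apply: prodr_ge0 => i _; rewrite le_max lexx.
pose J k : set R := `[a k ord0, b k ord0]%classic.
pose D : set R := `[0, 1]%classic.
have mD : measurable D by exact: measurable_itv.
(* Fixing the first coordinate at [t] keeps the boxes with [t] in [J k]. The indicator joins the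
   coefficient, so the induction hypothesis covers the slice; integrating over [t] then restores the
   missing side length. *)
have slice t : D t -> (1 <= \sum_(k <oo) ((c k * v k)%:E * (\1_(J k) t)%:E))%E.
  rewrite /D /= in_itv /= => t01.
  have := IH (fun k => c k * \1_(J k) t) (fun k i => a k (lift ord0 i))
     (fun k i => b k (lift ord0 i)).
  under eq_eseriesr do rewrite -mulrA (mulrC (\1_(J _) t)) mulrA EFinM.
  apply => [k|x x01]; first by rewrite mulr_ge0.
  pose y i := if unlift ord0 i is Some j then x j else t.
  have [|k [ck kP]] := cov y.
    by move=> i; rewrite /y; case: unliftP.
  exists k; split=> [|i]; last by have := kP (lift ord0 i); rewrite /y liftK.
  rewrite indicE mem_set ?mulr1 //.
  by have := kP ord0; rewrite /y unlift_none /J /= in_itv.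
have : (\int[@lebesgue_measure R]_(t in D) (cst 1%E) t <=
    \int[@lebesgue_measure R]_(t in D)
      (\sum_(k <oo) ((c k * v k)%:E * (\1_(J k) t)%:E)))%E.
  apply: ge0_le_integral => //.
  apply: ge0_emeasurable_sum => [k t Dt _|k _].
    by rewrite mule_ge0 // lee_fin ?mulr_ge0.
  apply: emeasurable_funM => //; apply/measurable_EFinP.
  by apply: measurable_indic; exact: measurable_itv.
have mu_itv (i : interval R) : @lebesgue_measure R [set` i] = _ := lebesgue_measure_itv i.
rewrite integral_cst // mul1e /D [X in (X <= _)%E -> _]mu_itv /= lte_fin ltr01 sube0.
move=> /le_trans; apply.
rewrite integral_nneseries //; last 2 first.
- move=> k; apply: emeasurable_funM => //; apply/measurable_EFinP.
  by apply: measurable_indic; exact: measurable_itv.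
- by move=> k t _; rewrite mule_ge0 // lee_fin ?mulr_ge0.
apply: lee_nneseries => [k _ _|k _].
  by apply: integral_ge0 => t _; rewrite mule_ge0 // lee_fin ?mulr_ge0.
rewrite ge0_integralZl //; last 2 first.
- by apply/measurable_EFinP; apply: measurable_indic; exact: measurable_itv.
- by rewrite lee_fin mulr_ge0.
rewrite big_ord_recl (mulrC (Num.max _ _)) mulrA -/(v k) [leRHS]EFinM.
rewrite lee_wpmul2l ?lee_fin ?mulr_ge0 //.
rewrite integral_indic //; last exact: measurable_itv.
apply: (@le_trans _ _ (lebesgue_measure (J k))).
  by apply: le_measure; rewrite ?inE; [apply: measurableI|exact: measurable_itv|]; try exact: measurable_itv.
rewrite /J lebesgue_measure_itv /= lte_fin.
case: ifPn => ab; first by rewrite -EFinB lee_fin le_max lexx orbT.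
by rewrite lee_fin le_max lexx.
Qed.

(** The source of all positive lower bounds on volumes: an infimum over covers could a priori vanish
    identically. *)
Lemma lebesgue_outer_unit_cube (R : realType) (n : nat) :
  (1%:E <= lebesgue_outer R n [set z : 'rV[R]_n.+1 | forall i, (0 <= z 0 i <= 1)%R])%E.
Proof.
apply: le_ereal_inf_tmp => _ [p cov <-].
have := @cube_cover_volume R n.+1 (fun=> 1) (fun k => (p k).1 0) (fun k => (p k).2 0).
under eq_eseriesr do rewrite mul1r.
apply=> // x x01; have [|k _ kx] := cov (\row_i x i).
  by move=> i; rewrite mxE.
by exists k; split=> // i; have := kx i; rewrite mxE.
Qed.

(** * Lebesgue measurability of open sets and continuous functions *)

Section LebesgueMeasurability.
Context {R : realType} {n : nat}.
Local Notation E := 'rV[R]_n.+1.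
Implicit Types (A U : set E) (z : E) (i : 'I_n.+1) (c : R).

(** The Caratheodory criterion holds because the hyperplane cuts every covering box into two boxes,
    [lo] and [hi], whose volumes add up exactly, also when one of them is empty. *)
Lemma measurable_coord_le i c :
  measurable ([set z : E | z 0 i <= c] : set (Rn R n)).
Proof.
apply: le_caratheodory_measurable => X.
apply: le_ereal_inf_tmp => _ [p pX <-].
pose lo k : E * E :=
  ((p k).1, \row_j (if j == i then Num.min ((p k).2 0 j) c else (p k).2 0 j)).
pose hi k : E * E :=
  (\row_j (if j == i then Num.max ((p k).1 0 j) c else (p k).1 0 j), (p k).2).
have vol k : box_volume (p k) = box_volume (lo k) + box_volume (hi k).
  rewrite /box_volume (bigD1 i) //= [X in _ = X + _](bigD1 i) //=.
  rewrite [X in _ = _ + X](bigD1 i) //= !mxE eqxx.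
  have -> : \prod_(j < n.+1 | j != i) Num.max 0 ((lo k).2 0 j - (lo k).1 0 j) =
      \prod_(j < n.+1 | j != i) Num.max 0 ((p k).2 0 j - (p k).1 0 j).
    by apply: eq_bigr => j /negbTE ji; rewrite !mxE ji.
  have -> : \prod_(j < n.+1 | j != i) Num.max 0 ((hi k).2 0 j - (hi k).1 0 j) =
      \prod_(j < n.+1 | j != i) Num.max 0 ((p k).2 0 j - (p k).1 0 j).
    by apply: eq_bigr => j /negbTE ji; rewrite !mxE ji.
  rewrite -mulrDl; congr (_ * _); rewrite /Num.max /Num.min.
  by repeat case: ifPn => //; rewrite -?leNgt; lra.
rewrite (eq_eseriesr (fun k _ => congr1 EFin (vol k))).
under eq_eseriesr do rewrite EFinD.
rewrite nneseriesD; last 2 first.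
- by move=> k _; rewrite lee_fin box_volume_ge0.
- by move=> k _; rewrite lee_fin box_volume_ge0.
apply: leeD; apply: ereal_inf_lbound.
- exists lo => // z [/pX [k _ kz] /= zc]; exists k => // j; rewrite mxE.
  have /andP[k1 k2] := kz j; rewrite k1 /=; case: eqP => [->|//].
  by rewrite le_min zc andbT; have /andP[] := kz i.
- exists hi => // z [/pX [k _ kz] /= /negP]; rewrite -ltNge => zc.
  exists k => // j; rewrite mxE.
  have /andP[k1 k2] := kz j; rewrite k2 andbT; case: eqP => [->|//].
  by rewrite ge_max (ltW zc) andbT; have /andP[] := kz i.
Qed.

Lemma measurable_coord i : measurable_fun setT ((fun z : E => z 0 i) : Rn R n -> R).
Proof.
apply: (measurability _ (RGenOInfty.measurableE R)) => _ [_ [x ->] <-].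
rewrite setTI (_ : _ @^-1` _ = ~` [set z : E | z 0 i <= x]).
  by apply: measurableC; exact: measurable_coord_le.
by apply/seteqP; split=> z /=; rewrite in_itv /= andbT real_ltNge ?num_real // => /negP.
Qed.

Lemma measurable_box (p : E * E) : measurable (box p : set (Rn R n)).
Proof.
rewrite (_ : box p = \bigcap_(i in setT)
    ((fun z : E => z 0 i) @^-1` `[p.1 0 i, p.2 0 i]%classic)).
  apply: fin_bigcap_measurable => // i _; rewrite -[X in measurable X]setTI.
  by apply: measurable_coord => //; exact: measurable_itv.
by apply/seteqP; split=> z pz i => [_|]; have := pz i; rewrite /= in_itv /= => // ->.
Qed.

(** An open set is the union of the boxes it contains that have rational center and half-side
    [1 / (k + 1)]; these are countably many. *)
Lemma open_measurableRn U : open U -> measurable (U : set (Rn R n)).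
Proof.
move=> Uo.
pose q (a : 'rV[rat]_n.+1 * nat) : E * E :=
  (\row_i (ratr (a.1 0 i) - a.2.+1%:R^-1), \row_i (ratr (a.1 0 i) + a.2.+1%:R^-1)).
pose C a : set E := [set z | box (q a) z /\ box (q a) `<=` U].
have -> : U = \bigcup_a C a.
  apply/seteqP; split=> [x Ux|x [a _ [xa aU]]]; last exact: aU.
  have /nbhs_normP [r /= r0 rU] : nbhs x U by exact: open_nbhs_nbhs.
  have [k kr] : exists k : nat, k.+1%:R^-1 < r / 2.
    by exists (Num.truncn (r / 2)^-1); rewrite invf_plt ?posrE ?divr_gt0 // truncnS_gt.
  have kp : 0 < k.+1%:R^-1 :> R by [].
  have /choice [y yP] : forall i, exists y : rat, x 0 i - k.+1%:R^-1 < ratr y < x 0 i + k.+1%:R^-1.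
    move=> i; have /rat_in_itvoo [y] : x 0 i - k.+1%:R^-1 < x 0 i + k.+1%:R^-1 by rewrite ltrBlDr -addrA ltrDl addr_gt0.
    by rewrite in_itv; exists y.
  exists (\row_i y i, k) => //; split=> [i|z zP].
    rewrite /q /= !mxE; have := yP i; move: (k.+1%:R^-1 : R) => t /andP[? ?].
    by apply/andP; split; lra.
  apply: rU => /=; rewrite [ltLHS]mx_normrE; apply/bigmax_ltP; split=> // -[j i] _.
  rewrite ord1 !mxE /=; have := yP i; have := zP i; rewrite /q /= !mxE.
  move: (k.+1%:R^-1 : R) kr => t tr /andP[? ?] /andP[? ?]; rewrite ltr_norml; apply/andP; split; lra.
apply: countable_bigcupT_measurable => [|a]; first exact: countableP.
have [aU|naU] := pselect (box (q a) `<=` U).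
  rewrite (_ : C a = box (q a)); first exact: measurable_box.
  by apply/seteqP; split=> z // [].
by rewrite (_ : C a = set0) //; apply/seteqP; split=> z // [].
Qed.

Lemma continuous_measurable_funRn (f : E -> R) :
  continuous f -> measurable_fun setT (f : Rn R n -> R).
Proof.
move=> /continuousP cf.
apply: (measurability _ (RGenOpens.measurableE R)) => _ [_ [a [b ->]] <-].
by rewrite setTI; apply/open_measurableRn/cf/interval_open.
Qed.

(** The topology comes from the sup norm. Equivalence of the two norms lets every later continuity
    argument use Euclidean balls. *)
Lemma nbhs_enormP (x : E) (P : set E) :
  nbhs x P <-> exists2 d, 0 < d & forall y, enorm (y - x) < d -> P y.
Proof.
split=> [/nbhs_normP [d d0 dP]|[d d0 dP]].
  exists d => // y yx; apply: dP => /=.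
  by apply: le_lt_trans yx; rewrite -normrN opprB norm_le_enorm.
apply: (nbhs_normP x P).2; exists (d / n.+1%:R); first by rewrite /= divr_gt0.
move=> y /= xy; apply: dP; apply: le_lt_trans (enorm_le_norm _) _.
by rewrite mulrC -ltr_pdivlMr // -normrN opprB.
Qed.

Lemma continuous_at_enormP (f : E -> R) (x : E) :
  {for x, continuous f} <-> forall e, 0 < e ->
    exists2 d, 0 < d & forall y, enorm (y - x) < d -> `|f x - f y| < e.
Proof.
split=> [fx e e0|fx].
  by have /(@cvgrPdist_lt _ _ _ _ (nbhs_filter x))/(_ e e0)/nbhs_enormP := fx.
apply/(@cvgrPdist_lt _ _ _ _ (nbhs_filter x)) => e e0.
by have /nbhs_enormP : exists2 d, 0 < d & forall y, enorm (y - x) < d -> `|f x - f y| < e by exact: fx.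
Qed.

Lemma continuous_enorm : continuous (enorm : E -> R).
Proof.
move=> x; apply/continuous_at_enormP => e e0; exists e => // y.
apply: le_lt_trans; rewrite ler_norml lerNl opprB enorm_subl /=.
by rewrite (enorm_distC y) enorm_subl.
Qed.

Lemma continuous_dotv (e : E) : continuous (dotv e).
Proof.
move=> x; apply/continuous_at_enormP => d d0.
have e0 : 0 < enorm e + 1 by rewrite ltr_wpDl ?enorm_ge0.
exists (d / (enorm e + 1)); first by rewrite divr_gt0.
move=> y; rewrite ltr_pdivlMr // => yx.
have le : enorm e * enorm (y - x) <= enorm (y - x) * (enorm e + 1).
  by rewrite mulrC ler_wpM2l ?enorm_ge0 // lerDl.
have := dotv_le e (y - x); have := dotv_ge e (y - x).
by rewrite dotvDr dotvNr => ? ?; rewrite ltr_norml; apply/andP; split; lra.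
Qed.

Lemma eball_open (x : E) c : open (eball x c).
Proof.
rewrite openE => y; rewrite /eball /= => yx; apply/nbhs_enormP.
exists (c - enorm (y - x)); first by rewrite subr_gt0.
move=> z zy /=; apply: le_lt_trans (enormBD z y x) _.
by rewrite -ltrBrDr.
Qed.

Lemma measurable_annulus c : measurable (annulus c : set (Rn R n)).
Proof. by apply: measurableD; apply: open_measurableRn; exact: eball_open. Qed.

Lemma measurable_dotv (e : E) : measurable_fun setT (dotv e : Rn R n -> R).
Proof. exact/continuous_measurable_funRn/continuous_dotv. Qed.

Lemma measurable_enorm : measurable_fun setT (enorm : Rn R n -> R).
Proof. exact/continuous_measurable_funRn/continuous_enorm. Qed.

Lemma annulusE c z : annulus c z <-> c <= enorm z < 2 * c.
Proof.
rewrite /annulus /eball /= subr0; split=> [[-> /negP]|/andP[a ->]].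
  by rewrite -leNgt andbT.
by split=> //; apply/negP; rewrite -leNgt.
Qed.

End LebesgueMeasurability.

(** * Volumes of balls, annuli and halves of symmetric sets *)

Section Volumes.
Context {R : realType} {n : nat}.
Local Notation E := 'rV[R]_n.+1.
Local Notation vol := (lebesgueRn R n).
Implicit Types (A : set E) (e z : E) (mu t d : R).

Lemma enorm_delta (i : 'I_n.+1) : enorm ('e_i : E) = 1.
Proof.
rewrite /enorm (bigD1 i) //= !mxE !eqxx expr1n big1 ?addr0 ?sqrtr1 // => j ji.
by rewrite !mxE /= (negbTE ji) expr0n.
Qed.

Lemma ball_volume_lty d : (vol (eball 0 d) < +oo)%E.
Proof.
apply: (@le_lt_trans _ _ (box_volume (- const_mx d : E, const_mx d))%:E); last exact: ltry.
pose p (k : nat) : E * E := if k is 0%N then (- const_mx d, const_mx d) else (0, 0).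
apply: ereal_inf_lbound => /=; exists p.
  move=> z; rewrite /eball /= subr0 => zd; exists 0%N => // i; rewrite !mxE.
  by rewrite -ler_norml (le_trans (coord_le_enorm z i)) // ltW.
rewrite (@nneseriesD1 _ _ 0 xpredT) //; last by move=> k _; rewrite lee_fin box_volume_ge0.
rewrite eseries0 ?adde0 // => -[|k] // _ _; congr EFin.
by rewrite /box_volume big_ord_recl /= subrr maxxx mul0r.
Qed.

Lemma ball_scale c d : 0 < c -> eball (0 : E) (c * d) = [set c *: z | z in eball 0 d].
Proof.
move=> c0; apply/seteqP; split=> [z|_ [z zd <-]]; rewrite /eball /= subr0.
  move=> zd; exists (c^-1 *: z); last by rewrite scalerKV // gt_eqF.
  by rewrite subr0 enormZ gtr0_norm ?invr_gt0 // mulrC ltr_pdivrMr // mulrC.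
by move: zd; rewrite /eball /= subr0 enormZ gtr0_norm // ltr_pM2l.
Qed.

Lemma ball_volume c d : 0 < c ->
  vol (eball 0 (c * d)) = ((c ^+ n.+1)%:E * vol (eball 0 d))%E.
Proof. by move=> c0; rewrite ball_scale // /vol; exact: lebesgue_outer_scale. Qed.

Lemma annulus_scale d : 0 < d -> annulus d = [set d *: z | z in annulus (1 : R)] :> set E.
Proof.
move=> d0; apply/seteqP; split=> [z /annulusE zd|_ [z /annulusE zd <-]]; last first.
  apply/annulusE; rewrite enormZ gtr0_norm //; case/andP: zd => ? ?.
  by apply/andP; split; nra.
exists (d^-1 *: z); last by rewrite scalerKV // gt_eqF.
apply/annulusE; rewrite enormZ gtr0_norm ?invr_gt0 // mulrC ler_pdivlMr //.
by rewrite ltr_pdivrMr //; lra.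
Qed.

Lemma unit_annulus_volume_gt0 : (0 < vol (annulus 1))%E.
Proof.
(* The cube of side [h] placed at ['e_0] has first coordinate at least 1, and this [h] keeps
   [h *: z] shorter than 1 on the unit cube, so the cube lies in the annulus. *)
pose h : R := (2 * n.+1%:R)^-1.
have h0 : 0 < h by rewrite invr_gt0 mulr_gt0.
pose Q := [set z : E | forall i, (0 <= z 0 i <= 1)].
apply: (@lt_le_trans _ _ (lebesgue_outer R n [set 'e_0 + z | z in [set h *: z | z in Q]])).
  rewrite lebesgue_outer_translate lebesgue_outer_scale //.
  rewrite mule_gt0 ?lte_fin ?exprn_gt0 //.
  exact: lt_le_trans (lebesgue_outer_unit_cube R n).
apply: le_lebesgue_outer => _ [_ [z zQ <-] <-]; apply/annulusE.
apply/andP; split.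
  apply: le_trans (coord_le_enorm _ 0); rewrite !mxE !eqxx /=.
  rewrite ger0_norm; have /andP[z0 _] := zQ 0; last by rewrite addr_ge0 ?mulr_ge0 // ltW.
  by rewrite lerDl mulr_ge0 // ltW.
apply: le_lt_trans (enormD _ _) _; rewrite enorm_delta mulr1 -ltrBrDl.
rewrite (_ : 2 - 1 = 1 :> R); last by lra.
rewrite enormZ gtr0_norm // mulrC ltr_pdivrMr ?mulr_gt0 // mul1r.
apply: le_lt_trans (enorm_le_norm _) _; rewrite mulrC ltr_pM2r //.
apply: (@le_lt_trans _ _ 1); last by lra.
rewrite [leLHS]mx_normrE; apply/bigmax_leP; split=> // -[i j] _ /=.
by rewrite ord1 ger0_norm; have /andP[] := zQ j.
Qed.

Lemma annulus_volume : exists2 v : R, 0 < v &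
  forall d, 0 < d -> vol (annulus d) = (v * d ^+ n.+1)%:E.
Proof.
have vp := unit_annulus_volume_gt0.
have vf : vol (annulus 1) \is a fin_num.
  rewrite ge0_fin_numE ?ltW //; apply: le_lt_trans (ball_volume_lty (2 * 1)).
  by apply: le_lebesgue_outer => z [].
exists (fine (vol (annulus 1))); first by rewrite -lte_fin fineK.
move=> d d0; rewrite annulus_scale // [LHS](lebesgue_outer_scale d (annulus 1) d0).
by rewrite mulrC EFinM fineK.
Qed.

(* The slab is thin because many disjoint translates of it along e fit into a
   ball of twice the radius. *)
Lemma slab_volume e m d : enorm e = 1 -> 0 < d -> (0 < m)%N ->
  (m%:R%:E * vol (eball 0 (2 * d) `&` [set z | `|dotv e z| <= d / (3 * m%:R)])%R <=
   vol (eball 0 (4 * d)%R))%E.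
Proof.
move=> e1 d0 m0.
have mR : 0 < m%:R :> R by rewrite ltr0n.
pose t := d / (3 * m%:R).
have t0 : 0 < t by rewrite divr_gt0 // mulr_gt0.
(* Slabs of half-width [t] centered [3 t] apart are disjoint, and [3 t m = d] keeps all [m] shifts
   within distance [d]. *)
pose a k : E := (3 * t * k%:R) *: e.
have ee : dotv e e = 1 by rewrite -sqr_enorm e1 expr1n.
pose S k : set E := eball (a k) (2 * d) `&` [set z | `|dotv e z - 3 * t * k%:R| <= t].
have Sa k : S k = [set a k + z | z in eball 0 (2 * d) `&` [set z | `|dotv e z| <= t]].
  apply/seteqP; split=> [z [zd zt]|_ [z [zd zt] <-]].
    exists (z - a k); last by rewrite addrC subrK.
    split; first by move: zd; rewrite /eball /= subr0.
    by rewrite /= dotvDr dotvNr dotvZr ee mulr1.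
  split; first by move: zd; rewrite /eball /= subr0 addrC addKr.
  by rewrite /= dotvDr dotvZr ee mulr1 addrC addKr.
have mS k : measurable (S k : set (Rn R n)).
  apply: measurableI; first exact/open_measurableRn/eball_open.
  rewrite (_ : [set z | _] = dotv e @^-1` `[3 * t * k%:R - t, 3 * t * k%:R + t]%classic).
    by rewrite -[X in measurable X]setTI; apply: measurable_dotv => //; exact: measurable_itv.
  apply/seteqP; split=> z; rewrite /= in_itv /= ler_norml => /andP[? ?]; apply/andP; split; lra.
have dS : trivIset setT S.
  apply: ltn_trivIset => k j kj; apply/seteqP; split=> // z [[_ /= zj] [_ /= zk]].
  have : j%:R + 1 <= k%:R :> R by rewrite natr1 ler_nat.
  move=> h; have : 3 * t * (j%:R + 1) <= 3 * t * k%:R by rewrite ler_wpM2l // mulr_ge0 ?ltW.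
  by move: zj zk; rewrite !ler_norml => /andP[? ?] /andP[? ?]; lra.
have -> : (m%:R%:E * vol (eball 0 (2 * d) `&` [set z | `|dotv e z| <= t])%R =
    \sum_(k < m) vol (S k))%E.
  under eq_bigr do rewrite Sa [vol _](lebesgue_outer_translate).
  by rewrite sumr_const card_ord mule_natl.
rewrite -measure_bigsetU_ord //.
apply: le_measure; rewrite ?inE.
- by apply: bigsetU_measurable => k _.
- exact/open_measurableRn/eball_open.
- move=> z; rewrite -(bigcup_mkord m) => -[k /= km [za _]].
  rewrite /eball /= (le_lt_trans (enormBD z (a k) 0)) // subr0.
  rewrite (_ : 4 * d = 2 * d + 2 * d); last by ring.
  apply: ltr_leD => //; rewrite enormZ e1 mulr1 ger0_norm; last first.
    by rewrite !mulr_ge0 // ltW.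
  have tm : 3 * t * m%:R = d by rewrite /t; field; rewrite gt_eqF.
  have : 3 * t * k%:R <= 3 * t * m%:R.
    by apply: ler_wpM2l; [exact/mulr_ge0/ltW|rewrite ler_nat ltnW].
  by move=> h; lra.
- apply/trivIsetP => i j _ _ ij; have /trivIsetP := dS; apply=> //.
Qed.

(** By symmetry the parts of [A] on the two sides of the slab [|e.z| <= t d] have equal volume. A
    thin slab takes at most half of the guaranteed volume, and each side keeps a quarter of it. The
    constants depend neither on the direction nor on [A]. *)
Lemma symmetric_halfspace_volume mu : 0 < mu -> exists2 t, 0 < t &
  exists2 c, 0 < c & forall d e (A : set (Rn R n)), 0 < d -> enorm e = 1 ->
    measurable A -> A `<=` annulus d -> A = [set - z | z in (A : set E)] ->
    (mu%:E * vol (annulus d) <= vol A)%E ->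
    ((c * d ^+ n.+1)%:E <= vol (A `&` [set z | (dotv e z < - (t * d))%R]))%E.
Proof.
move=> mu0; have [v v0 vE] := annulus_volume.
have [w w0 wE] : exists2 w, 0 <= w & vol (eball 0 (4 * 1)) = w%:E.
  exists (fine (vol (eball 0 (4 * 1)))); rewrite ?fine_ge0 ?measure_ge0 //.
  rewrite fineK // ge0_fin_numE ?measure_ge0 //; exact: ball_volume_lty.
(* The slab has volume at most [w d^(n+1) / m]; this [m] makes it at most half of [mu v d^(n+1)]. *)
pose m := (Num.truncn (2 * w / (mu * v))).+1.
have mR : 0 < m%:R :> R by [].
have wm : 2 * w <= m%:R * (mu * v).
  by rewrite -ler_pdivrMr ?mulr_gt0 // ltW // truncnS_gt.
exists (3 * m%:R)^-1; first by rewrite invr_gt0 mulr_gt0.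
exists (mu * v / 4); first by rewrite divr_gt0 // mulr_gt0.
move=> d e A d0 e1 mA Ad AN muA.
have dn : 0 < d ^+ n.+1 by rewrite exprn_gt0.
set t := (3 * m%:R)^-1 * d.
have tE : t = d / (3 * m%:R) by rewrite /t mulrC.
pose N : set (Rn R n) := [set z | dotv e z < - t].
pose P : set (Rn R n) := [set z | t < dotv e z].
pose Z : set (Rn R n) := [set z | `|dotv e z| <= t].
have mN : measurable N.
  rewrite (_ : N = dotv e @^-1` `]-oo, - t[%classic); last first.
    by apply/seteqP; split=> z; rewrite /= in_itv.
  by rewrite -[X in measurable X]setTI; apply: measurable_dotv => //; exact: measurable_itv.
have mP : measurable P.
  rewrite (_ : P = dotv e @^-1` `]t, +oo[%classic); last first.
    by apply/seteqP; split=> z; rewrite /= in_itv /= andbT.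
  by rewrite -[X in measurable X]setTI; apply: measurable_dotv => //; exact: measurable_itv.
have mZ : measurable Z.
  rewrite (_ : Z = dotv e @^-1` `[- t, t]%classic); last first.
    by apply/seteqP; split=> z; rewrite /Z /= in_itv /= ler_norml.
  by rewrite -[X in measurable X]setTI; apply: measurable_dotv => //; exact: measurable_itv.
have PN : vol (A `&` P) = vol (A `&` N).
  rewrite -[LHS]lebesgue_outer_opp; congr (lebesgue_outer R n _).
  apply/seteqP; split=> [_ [z [Az Pz] <-]|z [Az Nz]].
    split; last by rewrite /N /= dotvNr ltrN2.
    by rewrite AN; exists z.
  exists (- z); last by rewrite opprK.
  split; last by rewrite /P /= dotvNr ltrNr.
  by rewrite AN; exists z.
have ZB : (m%:R%:E * vol (A `&` Z) <= (w * d ^+ n.+1)%:E)%E.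
  rewrite mulrC EFinM -wE -ball_volume // mulr1 (mulrC d).
  apply: le_trans (slab_volume e m d e1 d0 _); last by [].
  rewrite lee_wpmul2l ?lee_fin //; apply: le_lebesgue_outer => z [Az Zz].
  split; first by have [] := Ad _ Az.
  by rewrite /= -tE.
have fA (B : set (Rn R n)) : vol (A `&` B) \is a fin_num.
  rewrite ge0_fin_numE ?measure_ge0 //.
  apply: le_lt_trans (ball_volume_lty (2 * d)).
  by apply: le_lebesgue_outer => z [/Ad []].
have le3 : (vol A <= vol (A `&` Z) + (vol (A `&` N) + vol (A `&` P)))%E.
  have [mAZ [mAN mAP]] : measurable (A `&` Z) /\ measurable (A `&` N) /\ measurable (A `&` P).
    by split; [|split]; exact: measurableI.
  apply: le_trans (leeD (lexx _) (measureU2 vol mAN mAP)).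
  apply: le_trans (measureU2 vol mAZ (measurableU _ _ mAN mAP)).
  apply: le_lebesgue_outer => z Az.
  have [zt|tz] := leP (dotv e z) t; last by right; right.
  have [zt'|tz'] := leP (- t) (dotv e z); last by right; left.
  by left; split=> //; rewrite /Z /= ler_norml zt' zt.
move: muA le3 ZB; rewrite vE // PN -/N.
rewrite -(fineK (fA Z)) -(fineK (fA N)); move: (fine _) (fine _) => b a.
rewrite -!EFinD -!EFinM => h1 h2; move: (le_trans h1 h2).
rewrite !lee_fin => h3 h4.
suff : m%:R * (mu * v / 4 * d ^+ n.+1) <= m%:R * b by rewrite ler_pM2l.
have : m%:R * (mu * (v * d ^+ n.+1)) <= m%:R * (a + (b + b)) by rewrite ler_pM2l.
have : 2 * w * d ^+ n.+1 <= m%:R * (mu * v) * d ^+ n.+1 by rewrite ler_pM2r.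
lra.
Qed.

End Volumes.

(** * Comparison of integrals, geometric series and dyadic scales *)

Lemma measurable_le_integral d (T : measurableType d) (R : realType)
    (mu : {measure set T -> \bar R}) (f g : T -> \bar R) :
  measurable_fun setT f -> measurable_fun setT g ->
  (forall x, (f x <= g x)%E) -> (\int[mu]_x f x <= \int[mu]_x g x)%E.
Proof.
(* No integrability is assumed: the positive parts are ordered one way and the negative parts the
   other, and subtraction of extended reals respects this. *)
move=> mf mg fg; rewrite integralE [leRHS]integralE.
apply: leeB; apply: ge0_le_integral => //; try exact: measurable_funepos; try exact: measurable_funeneg.
- by move=> x _; rewrite !funeposE ge_max !le_max lexx fg orbT.
- by move=> x _; rewrite !funenegE ge_max !le_max lexx leeN2 fg orbT.
Qed.

Lemma nneseries_geometric_le (R : realType) (u : nat -> R) (b q : R) :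
  0 <= b -> 0 <= q < 1 -> (forall j, 0 <= u j <= b * q ^+ j) ->
  (\sum_(j <oo) (u j)%:E <= (b / (1 - q))%:E)%E.
Proof.
move=> b0 /andP[q0 q1] ub.
apply: lime_le.
  by apply: is_cvg_nneseries => j _ _; rewrite lee_fin; have /andP[] := ub j.
apply: nearW => N; rewrite sumEFin lee_fin.
apply: (@le_trans _ _ (series (geometric b q) N)).
  by apply: ler_sum => j _ /=; have /andP[] := ub j.
rewrite geometric_seriesE ?lt_eqF //= ler_pM2r ?invr_gt0 ?subr_gt0 //.
by rewrite ler_piMr // gerBl exprn_ge0.
Qed.

Lemma powR_exprn (R : realType) (a x : R) (j : nat) : 0 <= a ->
  (a ^+ j) `^ x = (a `^ x) ^+ j.
Proof.
by move=> a0; rewrite -powR_mulrn // powRAC powR_mulrn // powR_ge0.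
Qed.

Lemma dyadic_floor (R : realType) (x : R) : 1 <= x ->
  exists j : nat, 2 ^+ j <= x < 2 ^+ j.+1.
Proof.
move=> x1; have ex : exists j : nat, x < 2 ^+ j.
  exists (Num.truncn x).+1; apply: lt_trans (truncnS_gt x) _.
  by rewrite -natrX ltr_nat ltn_expl.
case: (ex_minnP ex) => -[|j] xj jmin.
  by move: xj; rewrite expr0 ltNge x1.
exists j; rewrite xj andbT leNgt; apply/negP => /jmin; by rewrite ltnn.
Qed.

(** Compared with [dyadic_floor] the strict side is exchanged: the ratio [s / |z|] will be inverted,
    and the annuli are closed on the inside and open on the outside. *)
Lemma dyadic_ceil (R : realType) (x : R) : 1 < x ->
  exists j : nat, 2 ^+ j < x <= 2 ^+ j.+1.
Proof.
move=> x1; have ex : exists j : nat, x <= 2 ^+ j.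
  exists (Num.truncn x).+1; apply: le_trans (ltW (truncnS_gt x)) _.
  by rewrite -natrX ler_nat ltnW // ltn_expl.
case: (ex_minnP ex) => -[|j] xj jmin.
  by move: xj; rewrite expr0 leNgt x1.
exists j; rewrite xj andbT ltNge; apply/negP => /jmin; by rewrite ltnn.
Qed.

(** * Upper and lower mass bounds for kernels of the class *)

Section KernelEstimates.
Context {R : realType} {n : nat}.
Local Notation E := 'rV[R]_n.+1.
Local Notation vol := (lebesgueRn R n).
Context {sigma lambda Lambda mu : R}.
Hypotheses (sigma_gt0 : 0 < sigma) (sigma_lt2 : sigma < 2).
Hypotheses (lambda_gt0 : 0 < lambda) (lambda_le : lambda <= Lambda) (mu_gt0 : 0 < mu).
Local Notation kernels := (@kernel_class R n sigma lambda Lambda mu).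
Implicit Types (K : E -> R) (z e : E).

Let M : R := (2 - sigma) * Lambda.

Let M_ge0 : 0 <= M.
Proof. by rewrite mulr_ge0 ?subr_ge0 ?(ltW sigma_lt2) // (le_trans (ltW lambda_gt0)). Qed.

Lemma kernel_measurable K : kernels K -> measurable_fun setT (K : Rn R n -> R).
Proof. by case. Qed.

Lemma kernel_ge0 K z : kernels K -> 0 <= K z.
Proof. by case. Qed.

Lemma measurable_mul_kernel K (f : E -> R) : kernels K ->
  measurable_fun setT (f : Rn R n -> R) ->
  measurable_fun setT ((fun z => (f z * K z)%:E) : Rn R n -> \bar R).
Proof.
move=> KK mf.
apply/measurable_EFinP.
apply: measurable_funM.
exact: mf.
exact: kernel_measurable.
Qed.

(** [f] lies below the sum of [c j] times the indicator of the annulus of radius [rho j], and the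
    kernel mass bound turns the integral of this sum into a geometric series. One statement serves
    annuli shrinking to the origin and annuli growing to infinity. *)
Lemma kernel_annulus_sum K (f : E -> R) (rho c : nat -> R) (b q : R) : kernels K ->
  measurable_fun setT (f : Rn R n -> R) -> (forall z, 0 <= f z) ->
  (forall z, 0 < f z -> exists j, annulus (rho j) z /\ f z <= c j) ->
  (forall j, 0 < rho j) -> (forall j, 0 <= c j) -> 0 <= b -> 0 <= q < 1 ->
  (forall j, c j * (rho j) `^ (- sigma) <= b * q ^+ j) ->
  (\int[vol]_z (f z * K z)%:E <= (M * b / (1 - q))%:E)%E.
Proof.
move=> KK mf f0 fc rho0 c0 b0 q01 cb.
have K0 z := kernel_ge0 K z KK; have mK := kernel_measurable K KK.
pose g j (z : Rn R n) : \bar R := ((c j)%:E * ((K z)%:E * (\1_(annulus (rho j)) z)%:E))%E.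
have mg0 j : measurable_fun setT (fun z : Rn R n => ((K z)%:E * (\1_(annulus (rho j)) z)%:E)%E).
  apply: emeasurable_funM; apply/measurable_EFinP; first exact: mK.
  exact/measurable_indic/measurable_annulus.
have mg j : measurable_fun setT (g j) by exact: measurable_funeM.
have g0 j z : (0 <= g j z)%E by rewrite !mule_ge0 ?lee_fin.
apply: (@le_trans _ _ (\int[vol]_z \sum_(j <oo) g j z)%E).
  apply: ge0_le_integral.
  - exact: measurableT.
  - by move=> z _; rewrite lee_fin mulr_ge0.
  - exact: measurable_mul_kernel.
  - by apply: (@ge0_emeasurable_sum _ _ _ _ g xpredT) => [j z _ _|j _]; [exact: g0|exact: mg].
  move=> z _; have [fz|fz] := leP (f z) 0.
    rewrite (_ : f z = 0); last by apply/eqP; rewrite eq_le fz f0.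
    by rewrite mul0r; apply: nneseries_ge0.
  have [j [az fj]] := fc _ fz.
  apply: (@le_trans _ _ (g j z)).
    by rewrite /g indicE mem_set // mule1 -EFinM lee_fin ler_wpM2r.
  by rewrite (@nneseriesD1 _ _ j xpredT) // leeDl //; exact: nneseries_ge0.
rewrite integral_nneseries; [|exact: measurableT|exact: mg|by move=> j z _; exact: g0].
apply: (@le_trans _ _ (\sum_(j <oo) (M * (c j * (rho j) `^ (- sigma)))%:E)%E).
  apply: lee_nneseries => [j _ _|j _]; first exact: integral_ge0.
  rewrite ge0_integralZl; [|exact: measurableT|exact: mg0| |by rewrite lee_fin]; last first.
    by move=> z _; rewrite mule_ge0 ?lee_fin.
  rewrite mulrCA EFinM lee_wpmul2l ?lee_fin //.
  have [_ _ /(_ _ (rho0 j)) [+ _ _]] := KK.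
  rewrite [X in (X <= _)%E -> _]integral_mkcond; apply: le_trans.
  rewrite le_eqVlt; apply/orP; left; apply/eqP; apply: eq_integral => z _.
  by rewrite patchE indicE; case: ifP => _; rewrite ?mule1 ?mule0.
apply: nneseries_geometric_le => // [|j]; first exact: mulr_ge0.
apply/andP; split.
  by apply: mulr_ge0 => //; apply: mulr_ge0 => //; exact: powR_ge0.
by rewrite -mulrA; apply: ler_wpM2l.
Qed.

(** This weight and [far_weight] are the majorants of increments at scale [s]. For [theta > sigma]
    and [beta < sigma] their kernel integrals are at most multiples of [s^-sigma]. *)
Definition near_weight (theta s : R) z : R :=
  (enorm z / s) `^ theta * \1_(eball (0 : E) s) z.

Definition far_weight (beta s : R) z : R :=
  (enorm z / s) `^ beta * \1_(~` eball (0 : E) s) z.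

Lemma near_weight_ge0 theta s z : 0 <= near_weight theta s z.
Proof. by rewrite mulr_ge0 ?powR_ge0. Qed.

Lemma far_weight_ge0 beta s z : 0 <= far_weight beta s z.
Proof. by rewrite mulr_ge0 ?powR_ge0. Qed.

Let measurable_powR_enorm (theta s : R) :
  measurable_fun setT ((fun z : E => (enorm z / s) `^ theta) : Rn R n -> R).
Proof.
apply: (measurableT_comp (measurable_powR theta)).
by apply: measurable_funM; [exact: measurable_enorm|exact: measurable_cst].
Qed.

Lemma measurable_near_weight theta s :
  measurable_fun setT (near_weight theta s : Rn R n -> R).
Proof.
apply: measurable_funM; first exact: measurable_powR_enorm.
apply: measurable_indic.
exact/open_measurableRn/eball_open.
Qed.

Lemma measurable_far_weight beta s :
  measurable_fun setT (far_weight beta s : Rn R n -> R).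
Proof.
apply: measurable_funM; first exact: measurable_powR_enorm.
apply: measurable_indic; apply: measurableC.
exact/open_measurableRn/eball_open.
Qed.

Let powR2_lt1 (x : R) : x < 0 -> 0 <= (2 : R) `^ x < 1.
Proof.
move=> x0; rewrite powR_ge0 /= /powR gt_eqF // expR_lt1.
by rewrite nmulr_rlt0 // ln_gt0 // ltr1n.
Qed.

Let powR_half (x : R) : (2^-1 : R) `^ x = 2 `^ (- x).
Proof. by rewrite -powR_inv1 // -powRrM mulN1r. Qed.

Lemma near_weight_integral theta : sigma < theta -> exists2 C, 0 <= C &
  forall K s, kernels K -> 0 < s ->
  (\int[vol]_z (near_weight theta s z * K z)%:E <= (C * s `^ (- sigma))%:E)%E.
Proof.
move=> st; pose q : R := 2 `^ (sigma - theta).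
have q01 : 0 <= q < 1 by apply: powR2_lt1; rewrite subr_lt0.
have theta0 : 0 < theta by exact: lt_trans st.
have Q0 : 0 <= (1 - q)^-1 by rewrite invr_ge0 subr_ge0; case/andP: q01 => _ /ltW.
exists (M * 2 `^ sigma / (1 - q)).
  by apply: mulr_ge0 => //; apply: mulr_ge0 => //; exact: powR_ge0.
move=> K s KK s0.
have -> : M * 2 `^ sigma / (1 - q) * s `^ (- sigma) =
    M * (2 `^ sigma * s `^ (- sigma)) / (1 - q) by ring.
(* An annulus is named by its inner radius, hence the shift: the one of radius [s 2^-(j+1)] reaches
   up to [s 2^-j], where the weight is [2^(- j theta)]. The extra [2^sigma] in the constant comes
   from it. *)
apply: (kernel_annulus_sum K _ (fun j => s * 2^-1 ^+ j.+1) (fun j => (2^-1 ^+ j) `^ theta)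
  (2 `^ sigma * s `^ (- sigma)) q KK).
- exact: measurable_near_weight.
- exact: near_weight_ge0.
- move=> z; rewrite /near_weight indicE.
  have [/set_mem zs|_] := boolP (z \in eball 0 s); last by rewrite mulr0 ltxx.
  rewrite mulr1 => z0.
  have zp : 0 < enorm z.
    rewrite lt0r enorm_ge0 andbT; apply: contraTneq z0 => ->.
    by rewrite mul0r powR0 ?ltxx // gt_eqF.
  rewrite /eball /= subr0 in zs.
  have [j /andP[j1 j2]] : exists j : nat, 2 ^+ j < s / enorm z <= 2 ^+ j.+1.
    by apply: dyadic_ceil; rewrite ltr_pdivlMr // mul1r.
  have pj k : 0 < 2 ^+ k :> R by rewrite exprn_gt0.
  rewrite ltr_pdivlMr // in j1; rewrite ler_pdivrMr // in j2.
  exists j; split.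
    apply/annulusE; rewrite exprVn ler_pdivrMr // (mulrC (enorm z)) j2 /=.
    rewrite (_ : 2 * _ = s / 2 ^+ j); first by rewrite ltr_pdivlMr // mulrC.
    by rewrite exprS; field; rewrite gt_eqF.
  apply: ge0_ler_powR; rewrite ?nnegrE ?exprn_ge0 ?divr_ge0 ?(ltW zp) ?(ltW s0) ?(ltW theta0) ?invr_ge0 //.
  by rewrite exprVn ler_pdivrMr // mulrC ler_pdivlMr // mulrC ltW.
- by move=> j; rewrite mulr_gt0 // exprn_gt0 // invr_gt0.
- by move=> j; exact: powR_ge0.
- by rewrite mulr_ge0 ?powR_ge0.
- by [].
- move=> j; rewrite powRM ?exprn_ge0 ?(ltW s0) // !powR_exprn // !powR_half opprK.
  rewrite [q]powRD; last by rewrite pnatr_eq0 implybT.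
  rewrite exprS exprMn le_eqVlt; apply/orP; left; apply/eqP.
  by ring.
Qed.

Lemma far_weight_integral beta : 0 <= beta < sigma -> exists2 C, 0 <= C &
  forall K s, kernels K -> 0 < s ->
  (\int[vol]_z (far_weight beta s z * K z)%:E <= (C * s `^ (- sigma))%:E)%E.
Proof.
move=> /andP[beta0 st]; pose q : R := 2 `^ (beta - sigma).
have q01 : 0 <= q < 1 by apply: powR2_lt1; rewrite subr_lt0.
have Q0 : 0 <= (1 - q)^-1 by rewrite invr_ge0 subr_ge0; case/andP: q01 => _ /ltW.
exists (M * 2 `^ beta / (1 - q)).
  by apply: mulr_ge0 => //; apply: mulr_ge0 => //; exact: powR_ge0.
move=> K s KK s0.
have -> : M * 2 `^ beta / (1 - q) * s `^ (- sigma) =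
    M * (2 `^ beta * s `^ (- sigma)) / (1 - q) by ring.
have pj k : 0 < 2 ^+ k :> R by rewrite exprn_gt0.
apply: (kernel_annulus_sum K _ (fun j => s * 2 ^+ j) (fun j => (2 ^+ j.+1) `^ beta)
  (2 `^ beta * s `^ (- sigma)) q KK).
- exact: measurable_far_weight.
- exact: far_weight_ge0.
- move=> z; rewrite /far_weight indicE.
  have [/set_mem zs _|_] := boolP (z \in ~` eball 0 s); last by rewrite mulr0 ltxx.
  rewrite mulr1.
  have {}zs : s <= enorm z by rewrite leNgt; apply/negP; move: zs; rewrite /eball /= subr0.
  have [j /andP[j1 j2]] : exists j : nat, 2 ^+ j <= enorm z / s < 2 ^+ j.+1.
    by apply: dyadic_floor; rewrite ler_pdivlMr // mul1r.
  exists j; split.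
    apply/annulusE; rewrite mulrC -ler_pdivlMr // j1 /=.
    by rewrite mulrA -exprS -ltr_pdivrMr.
  apply: ge0_ler_powR; rewrite ?nnegrE ?exprn_ge0 ?divr_ge0 ?enorm_ge0 ?(ltW s0) ?(ltW j2) //.
- by move=> j; rewrite mulr_gt0.
- by move=> j; exact: powR_ge0.
- by rewrite mulr_ge0 ?powR_ge0.
- by [].
- move=> j; rewrite powRM ?exprn_ge0 ?(ltW s0) // !powR_exprn //.
  rewrite [q]powRD; last by rewrite pnatr_eq0 implybT.
  rewrite exprS exprMn le_eqVlt; apply/orP; left; apply/eqP.
  by ring.
Qed.

(** The set [D] is the part beyond the slab of the symmetric set where [K] is bounded below. The
    lower bound [d^(-(n+1)-sigma)] times a volume of order [d^(n+1)] leaves [d^-sigma]. The set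
    depends on [K], but [t] and [c] do not. *)
Lemma kernel_halfspace_mass : exists2 t, 0 < t & exists2 c, 0 < c &
  forall K d e, kernels K -> 0 < d -> enorm e = 1 ->
  exists D : set (Rn R n), [/\ measurable D,
    D `<=` annulus d `&` [set z | dotv e z < - (t * d)] &
    ((c * d `^ (- sigma))%:E <= \int[vol]_(z in D) (K z)%:E)%E].
Proof.
have [t t0 [c c0 tc]] := symmetric_halfspace_volume (R := R) (n := n) mu mu_gt0.
exists t => //; exists ((2 - sigma) * lambda * c); first by rewrite !mulr_gt0 // subr_gt0.
move=> K d e KK d0 e1; have [mK K0 /(_ d d0) [_ _ [A [mA Ad AN Amu AK]]]] := KK.
have mH : measurable ([set z | dotv e z < - (t * d)] : set (Rn R n)).
  rewrite (_ : [set z | _] = dotv e @^-1` `]-oo, - (t * d)[%classic); last first.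
    by apply/seteqP; split=> z; rewrite /= in_itv.
  by rewrite -[X in measurable X]setTI; apply: measurable_dotv => //; exact: measurable_itv.
pose D : set (Rn R n) := A `&` [set z | dotv e z < - (t * d)].
have mD : measurable D by exact: measurableI.
exists D; split=> //.
  by move=> z [/Ad Az ze].
pose k : R := (2 - sigma) * lambda * d `^ (- n.+1%:R - sigma).
have k0 : 0 <= k by rewrite !mulr_ge0 ?powR_ge0 ?subr_ge0 ?(ltW sigma_lt2) ?(ltW lambda_gt0).
have le1 : (\int[vol]_(z in D) (cst k%:E) z <= \int[vol]_(z in D) (K z)%:E)%E.
  apply: ge0_le_integral.
  - exact: mD.
  - by move=> z _; rewrite lee_fin.
  - exact: measurable_cst.
  - by apply/measurable_EFinP; apply: measurable_funS mK.
  - by move=> z [Az _]; rewrite lee_fin; exact: AK.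
apply: le_trans le1.
rewrite integral_cst //.
have kE : (k%:E * (c * d ^+ n.+1)%:E <= k%:E * vol D)%E.
  by apply: lee_wpmul2l; [rewrite lee_fin|exact: tc].
apply: le_trans kE.
rewrite -EFinM lee_fin le_eqVlt; apply/orP; left; apply/eqP.
rewrite /k powRD ?(gt_eqF d0) ?implybT // (powRN d n.+1%:R) powR_mulrn ?(ltW d0) //.
by field; rewrite expf_neq0 // gt_eqF.
Qed.

Lemma kernel_annulus_mass : exists2 c, 0 < c & forall K d, kernels K -> 0 < d ->
  ((c * d `^ (- sigma))%:E <= \int[vol]_(z in annulus d) (K z)%:E)%E.
Proof.
have [t t0 [c c0 tc]] := kernel_halfspace_mass; exists c => // K d KK d0.
have [D [mD Dd]] := tc K d 'e_0 KK d0 (enorm_delta 0); move=> /le_trans; apply.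
apply: ge0_subset_integral.
- exact: mD.
- exact: measurable_annulus.
- by apply/measurable_EFinP; apply: measurable_funS (kernel_measurable K KK).
- by move=> z _; rewrite lee_fin; exact: kernel_ge0.
- by move=> z /Dd [].
Qed.

End KernelEstimates.

(** * Integrals of weights, exterior gain and first moments against a kernel *)

Section DriftEstimate.
Context {R : realType} {n : nat}.
Local Notation E := 'rV[R]_n.+1.
Local Notation vol := (lebesgueRn R n).
Context {sigma lambda Lambda mu : R}.
Hypotheses (sigma_gt0 : 0 < sigma) (sigma_lt2 : sigma < 2).
Hypotheses (lambda_gt0 : 0 < lambda) (lambda_le : lambda <= Lambda) (mu_gt0 : 0 < mu).
Local Notation kernels := (@kernel_class R n sigma lambda Lambda mu).
Implicit Types (K : E -> R) (z e : E).

Lemma integral_mul_indic (D : set (Rn R n)) (f : E -> R) :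
  (\int[vol]_(z in D) (f z)%:E = \int[vol]_z (f z * \1_D z)%:E)%E.
Proof.
rewrite integral_mkcond; apply: eq_integral => z _.
by rewrite patchE indicE; case: ifP => _; rewrite ?mulr1 ?mulr0.
Qed.

Lemma ge0_integrable_kernel K (f : E -> R) (b : R) : kernels K ->
  measurable_fun setT (f : Rn R n -> R) -> (forall z, 0 <= f z) ->
  (\int[vol]_z (f z * K z)%:E <= b%:E)%E ->
  vol.-integrable setT (fun z => (f z * K z)%:E).
Proof.
move=> KK mf f0 fb; apply/integrableP; split; first exact: (measurable_mul_kernel K f KK mf).
apply: (@le_lt_trans _ _ b%:E); last exact: ltry.
apply: le_trans fb; rewrite le_eqVlt; apply/orP; left; apply/eqP.
apply: eq_integral => z _; rewrite gee0_abs // lee_fin.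
by apply: mulr_ge0; [exact: f0|exact: (kernel_ge0 K z KK)].
Qed.

Lemma kernel_annulus_integrable K d : kernels K -> 0 < d ->
  vol.-integrable setT (fun z => (\1_(annulus d) z * K z)%:E).
Proof.
move=> KK d0; apply: (ge0_integrable_kernel K _ ((2 - sigma) * Lambda * d `^ (- sigma)) KK).
- exact/measurable_indic/measurable_annulus.
- by [].
- have [_ _ /(_ _ d0) [+ _ _]] := KK; apply: le_trans.
  rewrite integral_mul_indic le_eqVlt; apply/orP; left; apply/eqP.
  by apply: eq_integral => z _; rewrite mulrC.
Qed.

Lemma kernel_moment_integrable K d e : kernels K -> 0 < d ->
  vol.-integrable setT (fun z => (dotv e z * \1_(annulus d) z * K z)%:E).
Proof.
move=> KK d0.
have mf : measurable_fun setT ((fun z => dotv e z * \1_(annulus d) z) : Rn R n -> R).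
  apply: measurable_funM; first exact: measurable_dotv.
  exact/measurable_indic/measurable_annulus.
apply: (le_integrable measurableT _ _
  (integrableZl measurableT (2 * d * enorm e) (kernel_annulus_integrable K d KK d0))).
- exact: (measurable_mul_kernel K _ KK mf).
- move=> z _; rewrite -EFinM !abse_EFin lee_fin !mulrA !normrM ler_wpM2r //.
  rewrite indicE; have [/set_mem/annulusE /andP[_ zd]|_] := boolP (z \in _); last by rewrite normr0 !mulr0.
  rewrite normr1 !mulr1 (ger0_norm (enorm_ge0 e)).
  apply: (@le_trans _ _ (enorm z * enorm e)).
    by rewrite mulrC ler_norml dotv_le dotv_ge.
  by rewrite ler_wpM2r ?enorm_ge0 // -normrM (le_trans (ltW zd)) // ler_norm.
Qed.

(** The factor [|1 - sigma|] in the first-moment bound vanishes, so each coordinate of the moment is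
    0; linearity gives every direction. *)
Lemma kernel_moment_eq0 K d e : sigma = 1 -> kernels K -> 0 < d ->
  (\int[vol]_z (dotv e z * \1_(annulus d) z * K z)%:E = 0)%E.
Proof.
move=> s1 KK d0.
have coord0 i : (\int[vol]_z (dotv 'e_i z * \1_(annulus d) z * K z)%:E = 0)%E.
  have [_ _ /(_ _ d0) [_ + _]] := KK.
  rewrite s1 subrr normr0 mulr0 mul0r => en0.
  pose m : E := \row_i (\int[vol]_(z in annulus d) ((z : E) 0 i * K z)).
  have : m 0 i = 0.
    by apply/eqP; rewrite -normr_le0 (le_trans (coord_le_enorm m i)).
  rewrite mxE /Rintegral integral_mul_indic => fin0.
  (* The moment in the kernel class is a real-valued integral, which is 0 by default on infinite
     values; integrability makes its vanishing meaningful. *)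
  rewrite -(fineK (integrable_fin_num measurableT (kernel_moment_integrable K d 'e_i KK d0))).
  rewrite -[RHS]/(0%:E); congr EFin; rewrite -[RHS]fin0; congr fine.
  by apply: eq_integral => z _; rewrite dotvC dotv_delta; congr EFin; ring.
transitivity (\int[vol]_z \sum_i ((e 0 i)%:E * (dotv 'e_i z * \1_(annulus d) z * K z)%:E))%E.
  apply: eq_integral => z _.
  under eq_bigr do rewrite -EFinM.
  rewrite sumEFin; congr EFin.
  under eq_bigr do rewrite !mulrA.
  rewrite -!mulr_suml; congr (_ * _ * _); apply: eq_bigr => i _; congr (_ * _).
  by rewrite dotvC dotv_delta.
rewrite integral_sum; last 2 first.
- exact: measurableT.
- move=> i; apply: integrableZl; first exact: measurableT.
  exact: kernel_moment_integrable.
rewrite big1 // => i _; rewrite integralZl ?coord0 ?mule0 //.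
exact: kernel_moment_integrable.
Qed.

(** A union of [J] annuli reaching up to the cut-off radius 1 of the increment at [sigma = 1].
    Stopping at [2^-J] keeps [|z| K z] integrable, which fails on the whole ball. *)
Definition dyadic_shell (J : nat) : set E := [set z | 2^-1 ^+ J <= enorm z < 1].

Lemma dyadic_shell_moment_eq0 K J e : sigma = 1 -> kernels K ->
  vol.-integrable setT (fun z => (dotv e z * \1_(dyadic_shell J) z * K z)%:E) /\
  (\int[vol]_z (dotv e z * \1_(dyadic_shell J) z * K z)%:E = 0)%E.
Proof.
move=> s1 KK; elim: J => [|J [IH1 IH2]].
  have r0 z : (dotv e z * \1_(dyadic_shell 0) z * K z)%:E = 0%E.
    rewrite indicE memNset ?mulr0 ?mul0r // => /= /andP[].
    by rewrite expr0 => /le_lt_trans h /h; rewrite ltxx.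
  split; last by under eq_integral do rewrite r0; rewrite integral0.
  rewrite (_ : (fun z => _) = cst 0%E); last exact/funext.
  exact: integrable0.
pose d : R := 2^-1 ^+ J.+1.
have d0 : 0 < d by rewrite exprn_gt0 // invr_gt0.
have d2 : 2 * d = 2^-1 ^+ J by rewrite /d exprS mulrA divff ?mul1r // pnatr_eq0.
have dJ : 2^-1 ^+ J <= 1 :> R by rewrite exprn_ile1 ?invr_ge0 // invf_le1 // ler1n.
have split_ring z : (dotv e z * \1_(dyadic_shell J.+1) z * K z)%:E =
    ((dotv e z * \1_(dyadic_shell J) z * K z)%:E + (dotv e z * \1_(annulus d) z * K z)%:E)%E.
  rewrite -EFinD -!mulrDl -!mulrDr; congr ((_ * _ * _)%:E).
  rewrite !indicE.
  have -> : (z \in dyadic_shell J.+1) = (2^-1 ^+ J.+1 <= enorm z < 1) by apply/idP/idP => [/set_mem|/mem_set].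
  have -> : (z \in dyadic_shell J) = (2^-1 ^+ J <= enorm z < 1) by apply/idP/idP => [/set_mem|/mem_set].
  have -> : (z \in annulus d) = (d <= enorm z < 2 * d).
    by apply/idP/idP => [/set_mem/annulusE//|h]; apply/mem_set/annulusE.
  rewrite d2 -/d; case: (leP (2^-1 ^+ J) (enorm z)) => h1; case: (leP d (enorm z)) => h2 /=; rewrite ?andbT ?andbF ?addr0 ?add0r //.
  - have : d <= 2^-1 ^+ J by rewrite -d2; lra.
    by lra.
  - by rewrite (lt_le_trans h1 dJ).
split.
  rewrite (_ : (fun z => _) = ((fun z => (dotv e z * \1_(dyadic_shell J) z * K z)%:E) \+
    (fun z => (dotv e z * \1_(annulus d) z * K z)%:E))%E); last exact/funext.
  by apply: integrableD => //; exact: kernel_moment_integrable.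
under eq_integral do rewrite split_ring.
rewrite (integralD measurableT IH1 (kernel_moment_integrable K d e KK d0)).
by rewrite IH2 kernel_moment_eq0 // adde0.
Qed.

(** The balance behind the barrier: the weights cost [al C s^-sigma], the exterior drop gains
    [ep c d^-sigma], and the linear term over the shell integrates to 0. [F] is bounded from above
    only, so integrability is unknown and the bound for [- F] is a separate conclusion. *)
Lemma drift_estimate beta theta : 0 <= beta < sigma -> sigma < theta ->
  exists2 t, 0 < t & exists2 c, 0 < c & exists2 C, 0 <= C &
  forall K (F : E -> R) (al ep p s d : R) (J : nat) e,
    kernels K -> measurable_fun setT (F : Rn R n -> R) ->
    0 <= al -> 0 <= ep -> 0 < s -> 0 < d -> enorm e = 1 ->
    (p = 0 \/ sigma = 1) ->
    (forall z, F z <= al * (near_weight theta s z + far_weight beta s z)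
       - ep * \1_(annulus d `&` [set z | dotv e z < - (t * d)]) z
       - p * (dotv e z * \1_(dyadic_shell J) z)) ->
    let v := al * (C * s `^ (- sigma)) - ep * (c * d `^ (- sigma)) in
    (\int[vol]_z (F z * K z)%:E <= v%:E)%E /\
    ((- v)%:E <= \int[vol]_z (- F z * K z)%:E)%E.
Proof.
move=> betas stheta.
have [t t0 [c c0 tc]] := @kernel_halfspace_mass R n sigma lambda Lambda mu sigma_lt2 lambda_gt0 mu_gt0.
have [C1 C10 near_le] := @near_weight_integral R n _ _ _ mu sigma_gt0 sigma_lt2 lambda_gt0 lambda_le theta stheta.
have [C2 C20 far_le] := @far_weight_integral R n _ _ _ mu sigma_lt2 lambda_gt0 lambda_le beta betas.
exists t => //; exists c => //; exists (C1 + C2); first exact: addr_ge0.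
move=> K F al ep p s d J e KK mF al0 ep0 s0 d0 e1 p0 FB v.
have [D [mD Dsub Dmass]] := tc K d e KK d0 e1.
have iN := ge0_integrable_kernel K _ _ KK (measurable_near_weight theta s)
  (near_weight_ge0 theta s) (near_le K s KK s0).
have iF := ge0_integrable_kernel K _ _ KK (measurable_far_weight beta s)
  (far_weight_ge0 beta s) (far_le K s KK s0).
have mDi : measurable_fun setT (\1_D : Rn R n -> R) by exact/measurable_indic.
have iD : vol.-integrable setT (fun z => (\1_D z * K z)%:E).
  apply: (le_integrable measurableT _ _ (kernel_annulus_integrable K d KK d0)).
    exact: (measurable_mul_kernel K _ KK mDi).
  move=> z _; have K0 := kernel_ge0 K z KK.
  rewrite !abse_EFin lee_fin !ger0_norm ?mulr_ge0 // ler_wpM2r //.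
  rewrite !indicE ler_nat; have [/set_mem/Dsub [Dz _]|//] := boolP (z \in D).
  by rewrite mem_set.
have [iM M0] : vol.-integrable setT (fun z => (p * (dotv e z * \1_(dyadic_shell J) z) * K z)%:E) /\
    (\int[vol]_z (p * (dotv e z * \1_(dyadic_shell J) z) * K z)%:E = 0)%E.
  have [->|s1] := p0.
    split; last by under eq_integral do rewrite !mul0r; rewrite integral0.
    rewrite (_ : (fun z => _) = cst 0%E); first exact: integrable0.
    by apply/funext => z; rewrite !mul0r.
  have [iM M0] := dyadic_shell_moment_eq0 K J e s1 KK.
  split.
    rewrite (_ : (fun z => _) = (fun z => p%:E * (dotv e z * \1_(dyadic_shell J) z * K z)%:E)%E).
      exact: integrableZl.
    by apply/funext => z; rewrite -EFinM; congr EFin; ring.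
  under eq_integral do rewrite -mulrA EFinM.
  by rewrite (integralZl measurableT iM) M0 mule0.
(* Linearity of the integral is applied only to the integrable majorant [h] built from these pieces;
   [F] enters through monotonicity alone. *)
pose N := fun z => (near_weight theta s z * K z)%:E.
pose G := fun z => (far_weight beta s z * K z)%:E.
pose H := fun z => (\1_D z * K z)%:E.
pose P := fun z => (p * (dotv e z * \1_(dyadic_shell J) z) * K z)%:E.
pose h1 := fun z => (N z + G z)%E.
pose h2 := fun z => (al%:E * h1 z)%E.
pose h3 := fun z => ((- ep)%:E * H z)%E.
pose h4 := fun z => (h2 z + h3 z)%E.
pose h := fun z => (h4 z - P z)%E.
have i1 : vol.-integrable setT h1 by exact: integrableD.
have i2 : vol.-integrable setT h2 by exact: integrableZl.
have i3 : vol.-integrable setT h3 by exact: integrableZl.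
have i4 : vol.-integrable setT h4 by exact: integrableD.
have ih : vol.-integrable setT h by exact: integrableB.
have hE : (\int[vol]_z h z <= v%:E)%E.
  rewrite (integralB measurableT i4 iM) M0 sube0.
  rewrite (integralD measurableT i2 i3).
  rewrite (integralZl measurableT i1) (integralZl measurableT iD).
  rewrite (integralD measurableT iN iF).
  have : ((c * d `^ (- sigma))%:E <= \int[vol]_z H z)%E.
    apply: le_trans Dmass _; rewrite integral_mul_indic le_eqVlt; apply/orP; left; apply/eqP.
    by apply: eq_integral => z _; rewrite mulrC.
  have := near_le K s KK s0; have := far_le K s KK s0.
  rewrite -(fineK (integrable_fin_num measurableT iN)) -(fineK (integrable_fin_num measurableT iF)).
  rewrite -(fineK (integrable_fin_num measurableT iD)).
  move: (fine _) (fine _) (fine _) => x1 x2 x3.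
  rewrite -(EFinD x2 x3) -(EFinM al) -(EFinM (- ep)) -EFinD !lee_fin => h1' h2' h3'.
  have := ler_wpM2l al0 h1'; have := ler_wpM2l al0 h2'; have := ler_wpM2l ep0 h3'.
  by rewrite /v; lra.
have mh : measurable_fun setT (h : Rn R n -> \bar R) by case/integrableP: ih.
have hF z : ((F z * K z)%:E <= h z)%E.
  rewrite (_ : h z = (al * (near_weight theta s z * K z + far_weight beta s z * K z)
    + - ep * (\1_D z * K z) - p * (dotv e z * \1_(dyadic_shell J) z) * K z)%:E) // lee_fin.
  have K0 := kernel_ge0 K z KK.
  have le1 : ep * \1_D z <= ep * \1_(annulus d `&` [set z | dotv e z < - (t * d)]) z.
    rewrite ler_wpM2l // !indicE ler_nat.
    by have [/set_mem/Dsub Dz|//] := boolP (z \in D); rewrite mem_set.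
  have le2 := ler_wpM2r K0 (FB z).
  have le3 := ler_wpM2r K0 le1.
  move: le2 le3; lra.
have mFK := measurable_mul_kernel K F KK mF.
split.
  by apply: le_trans hE; apply: measurable_le_integral => //.
rewrite EFinN leeNl; apply: le_trans hE; rewrite leeNl -integralN ?integrable_add_def //.
have mNF : measurable_fun setT ((fun z => - F z) : Rn R n -> R) by exact: measurableT_comp mF.
apply: measurable_le_integral.
- by case/integrableP: (integrableN ih).
- exact: (measurable_mul_kernel K _ KK mNF).
- by move=> z; rewrite mulNr EFinN leeN2.
Qed.

End DriftEstimate.

(** * Continuity, gradients and increments of test functions *)

Section RegularFunctions.
Context {R : realType} {n : nat}.
Local Notation E := 'rV[R]_n.+1.
Local Notation vol := (lebesgueRn R n).
Implicit Types (x z a : E) (phi : E -> R) (i : 'I_n.+1).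

Lemma lipschitz_inP phi (V : set E) :
  [lipschitz phi y | y in V] <->
  exists k : R, forall y z, V y -> V z -> `|phi y - phi z| <= k * `|y - z|.
Proof.
split=> [[k [_ kP]]|[k kP]].
  exists (k + 1) => y z Vy Vz.
  by have := kP (k + 1) (ltr_pwDr ltr01 (lexx k)) (y, z) (conj Vy Vz).
exists k; split; first exact: num_real.
move=> m km [y z] [/= Vy Vz]; apply: le_trans (kP y z Vy Vz) _.
by rewrite ler_wpM2r // ltW.
Qed.

Lemma partial_line phi a i (s : R) : derivable phi (a + s *: 'e_i) 'e_i ->
  is_derive s 1 (fun t : R => phi (a + t *: 'e_i)) (partial phi i (a + s *: 'e_i)).
Proof.
move=> dphi.
have E1 : (fun h : R => h^-1 *: (((fun t : R => phi (a + t *: 'e_i)) \o shift s) (h *: 1) -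
      phi (a + s *: 'e_i))) =
    (fun h : R => h^-1 *: ((phi \o shift (a + s *: 'e_i)) (h *: 'e_i) - phi (a + s *: 'e_i))).
  apply/funext => h; congr (_ *: (phi _ - _)).
  by rewrite /= [h *: 1]mulr1 scalerDl addrCA.
by split; [rewrite /derivable E1|rewrite /derive E1].
Qed.

Lemma line_increment_le phi a i (s B : R) : (forall y, derivable phi y 'e_i) ->
  (forall t, `|t| <= `|s| -> `|partial phi i (a + t *: 'e_i)| <= B) ->
  `|phi (a + s *: 'e_i) - phi a| <= B * `|s|.
Proof.
move=> dphi Bphi.
pose g t := phi (a + t *: 'e_i).
have dg t : is_derive t (1 : R) g (partial phi i (a + t *: 'e_i)) by exact: partial_line.
have cg u v : {within `[u, v], continuous g}.
  by apply: derivable_within_continuous => t _; exact: ex_derive.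
have -> : phi a = g 0 by rewrite /g scale0r addr0.
have B0 : 0 <= B by apply: le_trans (Bphi 0 _); rewrite ?normr0.
rewrite -/(g s); have [s0|s0] := leP 0 s.
  have [c] := @MVT_segment _ g _ 0 s s0 (fun t _ => dg t) (cg _ _).
  rewrite in_itv /= => /andP[c0 cs] ->; rewrite subr0 normrM ler_wpM2r //.
  by apply: Bphi; rewrite !ger0_norm.
have [c] := @MVT_segment _ g _ s 0 (ltW s0) (fun t _ => dg t) (cg _ _).
rewrite in_itv /= => /andP[cs c0] gE; rewrite distrC gE sub0r normrM normrN ler_wpM2r //.
by apply: Bphi; rewrite !ler0_norm ?lerN2 // ltW.
Qed.

(** Regularity is given through partial derivatives only. These are locally Lipschitz, hence locally
    bounded, and the mean value theorem along one axis at a time gives continuity. *)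
Lemma C2_continuous phi : C2 setT phi -> continuous phi.
Proof.
move=> C2phi.
suff main (x : E) (ep : R) : 0 < ep ->
    exists2 d, 0 < d & forall y : E, enorm (y - x) < d -> `|phi x - phi y| < ep.
  by move=> x; apply/continuous_at_enormP => ep; exact: main.
move=> ep0.
have dphi i (y : E) : derivable phi y 'e_i by have [+ _] := C2phi i; apply.
have /choice [r rP] i : exists r : R * R, 0 < r.1 /\
    forall y : E, enorm (y - x) < r.1 -> `|partial phi i y| <= r.2.
  have [_ /(_ x I) [V xV /lipschitz_inP [k kP]]] := C2phi i.
  have /nbhs_enormP [d d0 dV] := xV.
  have Vx : V x by apply: dV; rewrite subrr enorm0.
  exists (d, `|partial phi i x| + `|k| * d); split=> // y yx /=.
  have h1 : `|partial phi i y| - `|partial phi i x| <= `|k| * d.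
    apply: le_trans (lerB_dist _ _) (le_trans (kP y x (dV y yx) Vx) _).
    apply: (@le_trans _ _ (`|k| * `|y - x|)); first by rewrite ler_wpM2r // ler_norm.
    by rewrite ler_wpM2l // (le_trans (norm_le_enorm _)) // ltW.
  by rewrite -lerBlDl.
pose d := \big[Num.min/1]_i (r i).1.
have d0 : 0 < d by apply: lt_bigmin => // i _; case: (rP i).
pose B : R := \sum_i `|(r i).2| + 1.
have B0 : 0 < B by rewrite ltr_wpDl // sumr_ge0.
have BP i (y : E) : enorm (y - x) < d -> `|partial phi i y| <= B.
  move=> yx; have [_ rB] := rP i.
  apply: (@le_trans _ _ (r i).2).
    by apply: rB; apply: (lt_le_trans yx); exact: bigmin_le_cond.
  apply: le_trans (ler_norm _) _; rewrite /B (bigD1 i) //= -addrA lerDl.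
  by rewrite addr_ge0 // sumr_ge0.
have N0 : 0 < n.+1%:R :> R by [].
exists (Num.min (d / n.+1%:R) (ep / (n.+1%:R * B))).
  by rewrite lt_min !divr_gt0 // mulr_gt0.
move=> y; rewrite lt_min => /andP[]; rewrite !ltr_pdivlMr ?mulr_gt0 // => yd yep.
(* The path from [x] to [y] along the axes: the first [m] coordinates are already those of [y]. *)
pose h m : E := \row_j (if (j < m)%N then y 0 j else x 0 j).
have hx m (i : 'I_n.+1) t : i = m :> nat -> `|t| <= `|y 0 i - x 0 i| -> enorm (h m + t *: 'e_i - x) < d.
  move=> im ty; apply: le_lt_trans (enorm_le_norm _) _.
  apply: le_lt_trans yd; rewrite mulrC ler_wpM2r //.
  apply: (@le_trans _ _ `|y - x|); last exact: norm_le_enorm.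
  rewrite [leLHS]mx_normrE; apply/bigmax_leP; split=> // -[j k] _ /=.
  rewrite ord1 !mxE eqxx /=; have := coord_le_norm (y - x) k; rewrite !mxE.
  have [->|ki] := eqVneq k i.
    by rewrite im ltnn mulr1 (addrC (x 0 i)) addrK => /(le_trans ty).
  by rewrite mulr0 addr0; case: ifP => // _ _; rewrite subrr normr0.
have hS m (i : 'I_n.+1) : i = m :> nat -> h m.+1 = h m + (y 0 i - x 0 i) *: 'e_i.
  move=> im; apply/rowP => k; rewrite !mxE eqxx /=.
  have [->|ki] := eqVneq k i; first by rewrite im ltnSn ltnn mulr1 addrC subrK.
  by rewrite mulr0 addr0 ltnS leq_eqVlt -im (inj_eq val_inj) (negbTE ki).
have sumle m : (m <= n.+1)%N -> `|phi (h m) - phi x| <= m%:R * (B * enorm (y - x)).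
  elim: m => [_|m IH mn].
    rewrite (_ : h 0%N = x) ?subrr ?normr0 ?mul0r //.
    by apply/rowP => k; rewrite mxE ltn0.
  pose i := Ordinal mn.
  rewrite (hS m i erefl) -natr1 mulrDl mul1r.
  have -> (u v : R) : u - v = (phi (h m) - v) + (u - phi (h m)) by ring.
  apply: le_trans (ler_normD _ _) _; apply: lerD; first exact: (IH (ltnW mn)).
  apply: le_trans (line_increment_le phi (h m) i (y 0 i - x 0 i) B (dphi i) _) _.
    by move=> t ty; apply: BP; exact: hx.
  rewrite ler_wpM2l ?(ltW B0) //.
  by have := coord_le_enorm (y - x) i; rewrite !mxE.
have := sumle n.+1 (leqnn _).
rewrite (_ : h n.+1 = y); last by apply/rowP => k; rewrite mxE ltn_ord.
rewrite distrC => /le_lt_trans; apply; apply: le_lt_trans yep.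
by rewrite mulrA mulrC.
Qed.

(** An upper bound on both sides of [a] suffices: the difference quotient is at most [p + b t] at
    [t > 0] and at least [p - b t] at [- t]. *)
Lemma partial_touching phi a i (p b r : R) : derivable phi a 'e_i -> 0 < r ->
  (forall t, `|t| < r -> phi (a + t *: 'e_i) - phi a <= p * t + b * t ^+ 2) ->
  partial phi i a = p.
Proof.
move=> dphi r0 phi_le.
have : (fun h : R => h^-1 *: ((phi \o shift a) (h *: 'e_i) - phi a)) @ 0^' --> partial phi i a by exact: dphi.
set q := (fun h : R => _) => cq.
apply/eqP; rewrite -subr_eq0 -normr_le0; apply/ler_addgt0Pr => e e0; rewrite add0r.
have e20 : 0 < e / 2 by rewrite divr_gt0.
have /cvgrPdist_lt/(_ _ e20) [d /= d0 dP] := cq.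
pose t := Num.min (Num.min (d / 2) (r / 2)) (e / (2 * (`|b| + 1))).
have b1 : 0 < `|b| + 1 by rewrite ltr_wpDl.
have t0 : 0 < t by rewrite !lt_min !divr_gt0 // mulr_gt0.
have [td tr te] : [/\ t < d, t < r & `|b| * t <= e / 2].
  split.
  - by apply: (@le_lt_trans _ _ (d / 2)); [rewrite !ge_min lexx|lra].
  - by apply: (@le_lt_trans _ _ (r / 2)); [rewrite !ge_min lexx !orbT|lra].
  - apply: (@le_trans _ _ ((`|b| + 1) * t)); first by rewrite ler_wpM2r ?(ltW t0) // lerDl.
    rewrite mulrC -ler_pdivlMr // /t.
    by rewrite ge_min; apply/orP; right; rewrite -mulrA -invfM.
have bt : - (e / 2) <= b * t <= e / 2.
  by rewrite -ler_norml normrM (ger0_norm (ltW t0)).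
have q1 : q t <= p + e / 2.
  have := phi_le t; rewrite ger0_norm ?(ltW t0) // => /(_ tr) h.
  rewrite /q /= [_ *: _]mulrC ler_pdivrMr // (addrC _ a).
  by apply: le_trans h _; case/andP: bt => _ /(ler_wpM2r (ltW t0)); lra.
have q2 : p - e / 2 <= q (- t).
  have := phi_le (- t); rewrite normrN ger0_norm ?(ltW t0) // => /(_ tr) h.
  rewrite /q /= [_ *: _]mulrC invrN mulrN -mulNr ler_pdivlMr // (addrC _ a).
  by move: h; case/andP: bt => _ /(ler_wpM2r (ltW t0)); rewrite sqrrN expr2; lra.
have := dP t; rewrite /ball /= sub0r normrN ger0_norm ?(ltW t0) // => /(_ td).
rewrite gt_eqF // => /(_ isT); rewrite ltr_norml => /andP[_ h1].
have := dP (- t); rewrite /ball /= sub0r opprK ger0_norm ?(ltW t0) // => /(_ td).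
rewrite oppr_eq0 gt_eqF // => /(_ isT); rewrite ltr_norml => /andP[h2 _].
rewrite ler_norml; apply/andP; split; lra.
Qed.

Lemma C2b_continuous phi : C2b phi -> continuous phi.
Proof. by move=> [/C2_continuous]. Qed.

Lemma C2b_admissible d x phi : C2b phi -> admissible d x phi.
Proof.
move=> [C2phi [M [_ MP]]]; split=> [i|].
  by have [h1 h2] := C2phi i; split=> y _; [exact: h1|exact: h2].
split; first exact/continuous_measurable_funRn/C2_continuous.
exists (M + 1); apply: aeW => y; apply: (MP (M + 1)) => //.
by rewrite ltrDl.
Qed.

Lemma partialN phi i x : derivable phi x 'e_i -> partial (\- phi) i x = - partial phi i x.
Proof. exact: deriveN. Qed.

Lemma gradN phi x : (forall i, derivable phi x 'e_i) -> grad (\- phi) x = - grad phi x.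
Proof. by move=> dphi; apply/rowP => i; rewrite !mxE partialN. Qed.

Lemma incrementN sigma phi x z : (forall i, derivable phi x 'e_i) ->
  increment sigma (\- phi) x z = - increment sigma phi x z.
Proof.
move=> dphi; rewrite /increment gradN // dotvNl.
by case: ifP => _; [|case: ifP => _]; rewrite /=; ring.
Qed.

Lemma C2bN phi : C2b phi -> C2b (\- phi).
Proof.
move=> [C2phi [M [Mr MP]]]; split; last first.
  by exists M; split=> // m /MP mP y yT; rewrite /= normrN; exact: mP.
move=> i; have [d1 d2] := C2phi i; split=> x _; first exact/derivableN/d1.
have [V xV /lipschitz_inP [k kP]] := d2 x I.
exists V => //; apply/lipschitz_inP; exists k => y z Vy Vz.
rewrite (partialN phi i y (d1 y I)) (partialN phi i z (d1 z I)) -opprD normrN; exact: kP.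
Qed.

Lemma measurable_increment sigma phi x : C2b phi ->
  measurable_fun setT (increment sigma phi x : Rn R n -> R).
Proof.
move=> C2phi.
have mphi : measurable_fun setT ((fun z => phi (x + z) - phi x) : Rn R n -> R).
  apply: continuous_measurable_funRn => z; apply/continuous_at_enormP => e e0.
  have /continuous_at_enormP/(_ e e0) [d d0 dP] := C2b_continuous phi C2phi (x + z).
  exists d => // y yz; have := dP (x + y); rewrite opprD addrACA subrr add0r => /(_ yz).
  by rewrite (_ : _ - _ = phi (x + z) - phi (x + y)) //; ring.
have mgrad := measurable_dotv (grad phi x).
rewrite /increment; case: (sigma < 1); first exact: mphi.
case: (sigma == 1); last exact: measurable_funB.
apply: measurable_funB; first exact: mphi.
apply: measurable_funM; last exact: mgrad.
exact/measurable_indic/open_measurableRn/eball_open.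
Qed.

End RegularFunctions.

(** * Increments of the logarithmic barrier of a ball *)

Section LogBarrier.
Context {R : realType} {n : nat}.
Local Notation E := 'rV[R]_n.+1.
Implicit Types (x y z v : E) (al tau r : R).

(** With [a = |v|], [b = |v + z|] and [A] equal to [a] plus the right-hand side,
    [2 a A = a^2 + b^2], so [b^2 = 2 a A - a^2 <= A^2]. *)
Lemma enormD_le_tangent v z : v != 0 ->
  enorm (v + z) - enorm v <= dotv ((enorm v)^-1 *: v) z + enorm z ^+ 2 / (2 * enorm v).
Proof.
move=> v0; have vp : 0 < enorm v.
  by rewrite lt0r enorm_ge0 andbT; apply: contra v0 => /eqP/enorm_eq0 ->.
rewrite dotvZl lerBlDl.
set A := _ + (_ + _).
have AE : 2 * enorm v * A = enorm (v + z) ^+ 2 + enorm v ^+ 2.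
  rewrite sqr_enormD /A; field; exact: lt0r_neq0.
apply: enorm_le.
  by rewrite -(pmulr_rge0 _ (mulr_gt0 (ltr0Sn R 1) vp)) AE addr_ge0 ?sqr_ge0.
rewrite -sqr_enorm; have := sqr_ge0 (A - enorm v); move: AE.
by move: (enorm v) (enorm (v + z)) A => a b c; nra.
Qed.

Definition log_barrier al tau r y x : R :=
  al * ln (1 + Num.max 0 (enorm (x - y) - r) / tau).

Lemma log_barrier_ge0 al tau r y x : 0 <= al -> 0 < tau -> 0 <= log_barrier al tau r y x.
Proof.
move=> al0 tau0; rewrite mulr_ge0 // ln_ge0 // lerDl divr_ge0 ?(ltW tau0) //.
by rewrite le_max lexx.
Qed.

Lemma log_barrier_eq0 al tau r y x : enorm (x - y) <= r -> log_barrier al tau r y x = 0.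
Proof. by move=> xr; rewrite /log_barrier max_l ?subr_le0 // mul0r addr0 ln1 mulr0. Qed.

(** With [d] the distance to the ball, [(1 + |z| / (tau + d)) (1 + d / tau) = 1 + (d + |z|) / tau].
    Since [tau + d >= d], the resulting bound can be made uniform in [tau]. *)
Lemma log_barrier_increment_le al tau r y x z : 0 <= al -> 0 < tau -> r <= enorm (x - y) ->
  log_barrier al tau r y (x + z) - log_barrier al tau r y x <=
  al * ln (1 + enorm z / (tau + (enorm (x - y) - r))).
Proof.
move=> al0 tau0 rx; rewrite -mulrBr ler_wpM2l // lerBlDr.
set d := enorm (x - y) - r; have d0 : 0 <= d by rewrite subr_ge0.
have td : 0 < tau + d by rewrite ltr_pwDl.
have z0 := enorm_ge0 z.
have p1 : 0 < 1 + enorm z / (tau + d) by rewrite ltr_pwDl // divr_ge0 // ltW.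
have p2 : 0 < 1 + d / tau by rewrite ltr_pwDl // divr_ge0 // ltW.
rewrite (max_r d0) -lnM ?posrE // ler_ln ?posrE ?mulr_gt0 //; last first.
  by rewrite ltr_pwDl // divr_ge0 ?(ltW tau0) // le_max lexx.
have -> : (1 + enorm z / (tau + d)) * (1 + d / tau) = 1 + (d + enorm z) / tau.
  by field; rewrite !gt_eqF.
rewrite lerD2l ler_pM2r ?invr_gt0 // ge_max addr_ge0 //= /d.
by have := enormD (x - y) z; rewrite (addrAC x); lra.
Qed.

(** As long as [x + z] cannot enter the ball the truncation is inactive, and concavity of [ln]
    leaves the increment of the norm, whose linear part will be the gradient. *)
Lemma log_barrier_increment_le_near al tau r y x z : 0 <= al -> 0 < tau ->
  enorm z <= enorm (x - y) - r ->
  log_barrier al tau r y (x + z) - log_barrier al tau r y x <=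
  al / (tau + (enorm (x - y) - r)) * (enorm (x - y + z) - enorm (x - y)).
Proof.
move=> al0 tau0; set d := enorm (x - y) - r => zd.
have d0 : 0 <= d by rewrite (le_trans (enorm_ge0 z)).
have td : 0 < tau + d by rewrite ltr_pwDl.
rewrite /log_barrier -mulrBr -mulrA ler_wpM2l // -/d (max_r d0) addrAC.
set d' := enorm (x - y + z) - r.
have d'0 : 0 <= d'.
  have := enorm_subl (x - y) (- z); rewrite enormN opprK /d' => h.
  by move: zd h; rewrite /d; lra.
have td' : 0 < tau + d' by rewrite ltr_pwDl.
rewrite (max_r d'0).
have -> : 1 + d' / tau = (tau + d') / tau by field; rewrite gt_eqF.
have -> : 1 + d / tau = (tau + d) / tau by field; rewrite gt_eqF.
rewrite -ln_div ?posrE ?divr_gt0 // invf_div mulrA divfK ?gt_eqF //.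
apply: (@le_trans _ _ ((tau + d') / (tau + d) - 1)).
  rewrite -{1}(subrK 1 ((tau + d') / (tau + d))) addrC le_ln1Dx //.
  by rewrite ltrBrDl subrr divr_gt0.
rewrite le_eqVlt; apply/orP; left; apply/eqP; rewrite /d' /d; field.
by rewrite gt_eqF.
Qed.

(** Point and center both vary, so that one estimate gives continuity of a branch in [x] and in its
    center. *)
Lemma log_barrier_lipschitz al tau r y x y' x' : 0 <= al -> 0 < tau ->
  `|log_barrier al tau r y x - log_barrier al tau r y' x'| <=
  al / tau * `|enorm (x - y) - enorm (x' - y')|.
Proof.
move=> al0 tau0; rewrite /log_barrier; move: (enorm _) (enorm _) => b a.
wlog ab : a b / b <= a.
  by move=> H; have [/H//|/ltW/H] := leP b a; rewrite distrC (distrC b).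
set m := Num.max 0 (a - r); set m' := Num.max 0 (b - r).
have m'0 : 0 <= m' by rewrite le_max lexx.
have mm' : m' <= m by rewrite ge_max !le_max lexx lerD2r ab orbT.
have m0 : 0 <= m by exact: le_trans mm'.
have mab : m - m' <= a - b.
  rewrite lerBlDr ge_max; apply/andP; split; first by rewrite addr_ge0 // subr_ge0.
  have : b - r <= m' by rewrite le_max lexx orbT.
  by lra.
have p1 : 0 < 1 + m / tau by rewrite ltr_pwDl // divr_ge0 // ltW.
have p2 : 0 < 1 + m' / tau by rewrite ltr_pwDl // divr_ge0 // ltW.
have mt : m' / tau <= m / tau by rewrite ler_pM2r // invr_gt0.
have m't : 0 <= m' / tau by rewrite divr_ge0 // ltW.
rewrite -mulrBr normrM (ger0_norm al0) -mulrA ler_wpM2l // ger0_norm; last first.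
  by rewrite subr_ge0 ler_ln ?lerD2l ?posrE.
rewrite (ger0_norm (_ : 0 <= a - b)) ?subr_ge0 // -ln_div ?posrE //.
apply: (@le_trans _ _ ((m - m') / tau)); last first.
  by rewrite mulrC ler_wpM2l // invr_ge0 ltW.
apply: (@le_trans _ _ (ln (1 + (m - m') / tau))); last first.
  by rewrite le_ln1Dx // (lt_le_trans (ltrN10 R)) // divr_ge0 ?subr_ge0 // ltW.
rewrite ler_ln ?posrE ?divr_gt0 //; last by rewrite mulrBl; lra.
rewrite ler_pdivrMr // mulrBl; move: mt m't; move: (m / tau) (m' / tau) => u v.
by nra.
Qed.

(** Trades the logarithm for a power below [sigma], which the far weight absorbs: [ln (2 u) = ln ((2
    u)^b) / b <= (2 u)^b / b], and [2^b <= 2]. *)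
Lemma ln1D_le_powR (b u : R) : 0 < b <= 1 -> 1 <= u -> ln (1 + u) <= 2 / b * u `^ b.
Proof.
move=> /andP[b0 b1] u1; have u0 : 0 < u by exact: lt_le_trans u1.
have u2 : 0 < 2 * u by rewrite mulr_gt0.
apply: (@le_trans _ _ (ln (2 * u))); first by rewrite ler_ln ?posrE; lra.
have -> : ln (2 * u) = b^-1 * ln ((2 * u) `^ b).
  by rewrite ln_powR mulrA mulVf ?mul1r // gt_eqF.
apply: (@le_trans _ _ (b^-1 * (2 * u) `^ b)).
  by rewrite ler_wpM2l ?invr_ge0 ?(ltW b0) // ltW // ln_sublinear // powR_gt0.
rewrite powRM ?(ltW u0) // mulrA ler_wpM2r ?powR_ge0 //.
rewrite mulrC ler_wpM2r ?invr_ge0 ?(ltW b0) //.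
by rewrite -[leRHS]powRr1 // ler_powR // ler1n.
Qed.

End LogBarrier.

(** * Domination of the compensated barrier increment by the weights *)

Section BarrierProfile.
Context {R : realType} {n : nat}.
Local Notation E := 'rV[R]_n.+1.
Local Notation vol := (lebesgueRn R n).
Context {sigma lambda Lambda mu : R}.
Hypotheses (sigma_gt0 : 0 < sigma) (sigma_lt2 : sigma < 2).
Hypotheses (lambda_gt0 : 0 < lambda) (lambda_le : lambda <= Lambda) (mu_gt0 : 0 < mu).
Local Notation kernels := (@kernel_class R n sigma lambda Lambda mu).
Implicit Types (K phi : E -> R) (x y z e : E).

(* Exponents of the near and far weights; beta < sigma < theta makes both
   integrals converge. *)
Definition near_exponent : R := if sigma < 1 then 1 else 2.
Definition far_exponent : R := if 1 < sigma then 1 else sigma / 2.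
Local Notation theta := near_exponent.
Local Notation beta := far_exponent.

Lemma near_exponent_gt : sigma < theta.
Proof. by rewrite /theta; case: ifP. Qed.

Lemma far_exponent_bounds : [/\ 0 < beta, beta <= 1 & beta < sigma].
Proof.
rewrite /beta; case: (ltP 1 sigma) => s1; first by split.
have := sigma_gt0; have := sigma_lt2 => ? ?.
by split; [rewrite divr_gt0|rewrite ler_pdivrMr //; lra|rewrite ltr_pdivrMr //; lra].
Qed.

(** Touching from one side determines the gradient of [phi]; the tangent inequality gives the
    quadratic remainder along each axis. *)
Lemma grad_touching phi x v (p r : R) : C2b phi -> 0 < r -> v != 0 -> 0 <= p ->
  (forall z, enorm z < r -> phi (x + z) - phi x <= p * (enorm (v + z) - enorm v)) ->
  grad phi x = p *: ((enorm v)^-1 *: v).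
Proof.
move=> C2phi r0 v0 p0 phi_le; apply/rowP => i; rewrite mxE.
apply: (partial_touching phi x i _ (p / (2 * enorm v)) r) => //.
  by have [/(_ i) [+ _] _] := C2phi; apply.
move=> t tr; have te : enorm (t *: 'e_i : E) = `|t| by rewrite enormZ enorm_delta mulr1.
apply: le_trans (phi_le _ _) _; first by rewrite te.
apply: (@le_trans _ _ (p * (dotv ((enorm v)^-1 *: v) (t *: 'e_i) + `|t| ^+ 2 / (2 * enorm v)))).
  by rewrite ler_wpM2l // -te enormD_le_tangent.
by rewrite dotvZr dotv_delta real_normK ?num_real // !mxE; lra.
Qed.

Definition first_order_term (p : R) e z : R :=
  if sigma < 1 then 0
  else if sigma == 1 then \1_(eball (0 : E) 1) z * (p * dotv e z)
  else p * dotv e z.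

Lemma increment_first_order phi x z (p : R) e : grad phi x = p *: e ->
  increment sigma phi x z = phi (x + z) - phi x - first_order_term p e z.
Proof.
move=> ge; rewrite /increment /first_order_term ge dotvZl.
by case: (sigma < 1); rewrite ?subr0; case: (sigma == 1).
Qed.

(* The left-hand side is the increment of a log barrier at distance d from the
   ball, with its first-order part removed. *)
Lemma log_barrier_weights al tau r y x s (J : nat) z : 0 < al -> 0 < tau -> 0 < r ->
  let v := x - y in let d := enorm v - r in let e := (enorm v)^-1 *: v in
  let p := al / (tau + d) in
  s = 2^-1 ^+ J -> s < d ->
  log_barrier al tau r y (x + z) - log_barrier al tau r y x - first_order_term p e z <=
  al * (2 / beta + 2) * (near_weight theta s z + far_weight beta s z)
  - (if sigma == 1 then p else 0) * (dotv e z * \1_(dyadic_shell J) z).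
Proof.
move=> al0 tau0 r0 v d e p sJ sd.
have s0 : 0 < s by rewrite sJ exprn_gt0 // invr_gt0.
have s1 : s <= 1 by rewrite sJ exprn_ile1 ?invr_ge0 // invf_le1 // ler1n.
have d0 : 0 < d by exact: lt_trans sd.
have td : 0 < tau + d by rewrite addr_gt0.
have p0 : 0 < p by rewrite divr_gt0.
have ps : p * s <= al.
  by rewrite /p -mulrA ger_pMr // mulrC ler_pdivrMr // mul1r ltW // ltr_pwDl // ltW.
have vr : enorm v = r + d by rewrite /d addrC subrK.
have vp : 0 < enorm v by rewrite vr addr_gt0.
have v0 : v != 0 by apply: contraTneq vp => ->; rewrite enorm0 ltxx.
have e1 : enorm e = 1 by rewrite enormZ ger0_norm ?invr_ge0 ?(ltW vp) // mulVf // gt_eqF.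
have [b0 b1 bs] := far_exponent_bounds.
have B2 : 2 <= 2 / beta + 2 by rewrite lerDr divr_ge0 // ltW.
have Bb : 2 / beta + 1 <= 2 / beta + 2 by rewrite lerD2l ler1n.
have z0 := enorm_ge0 z.
have u0 : 0 <= enorm z / s by rewrite divr_ge0 // ltW.
have psz : p * enorm z <= al * (enorm z / s).
  rewrite mulrA ler_pdivlMr // mulrAC ler_wpM2r //.
have [zs|sz] := ltP (enorm z) s.
  have -> : \1_(dyadic_shell J) z = 0 :> R.
    by rewrite indicE memNset // => /andP[]; rewrite -sJ leNgt zs.
  have -> : far_weight beta s z = 0.
    by rewrite /far_weight indicE memNset ?mulr0 //= /eball /= subr0.
  have -> : near_weight theta s z = (enorm z / s) `^ theta.
    by rewrite /near_weight indicE mem_set ?mulr1 //= /eball /= subr0.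
  rewrite !mulr0 subr0 addr0.
  have W := log_barrier_increment_le_near al tau r y x z (ltW al0) tau0 (ltW (lt_trans zs sd)).
  have Wt := le_trans W (ler_wpM2l (ltW p0) (enormD_le_tangent v z v0)).
  have q0 : 0 <= (enorm z / s) `^ theta by exact: powR_ge0.
  apply: (@le_trans _ _ (al * (enorm z / s) `^ theta)); last first.
    by rewrite -mulrA ler_wpM2l ?(ltW al0) // ler_peMl //; lra.
  (* Below [sigma = 1] nothing is subtracted and the increment is of first order in [|z|]. Otherwise
     the linear parts cancel and second order remains. Hence the near exponents 1 and 2. *)
  rewrite /first_order_term /near_exponent; case: ifP => sig1.
    rewrite subr0 powRr1 //; apply: le_trans W (le_trans _ psz).
    rewrite ler_wpM2l ?(ltW p0) // lerBlDl; exact: enormD.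
  have -> : (if sigma == 1 then \1_(eball (0 : E) 1) z * (p * dotv e z) else p * dotv e z) = p * dotv e z.
    case: ifP => // _; rewrite indicE mem_set ?mul1r //= /eball /= subr0; exact: lt_le_trans s1.
  rewrite powR_mulrn // lerBlDl; apply: le_trans Wt _; rewrite mulrDr lerD2l.
  apply: (@le_trans _ _ (p * enorm z * (enorm z / s))).
    have vs : (2 * enorm v)^-1 <= s^-1 by rewrite lef_pV2 ?posrE ?mulr_gt0 //; lra.
    rewrite (_ : p * enorm z * (enorm z / s) = p * (enorm z ^+ 2 / s)); last by ring.
    by rewrite ler_wpM2l ?(ltW p0) // ler_wpM2l ?sqr_ge0.
  by rewrite expr2 [leRHS]mulrA ler_wpM2r.
have -> : near_weight theta s z = 0.
  by rewrite /near_weight indicE memNset ?mulr0 //= /eball /= subr0 => /lt_le_trans/(_ sz); rewrite ltxx.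
have -> : far_weight beta s z = (enorm z / s) `^ beta.
  rewrite /far_weight indicE mem_set ?mulr1 //= /eball /= subr0 => /lt_le_trans/(_ sz); by rewrite ltxx.
rewrite add0r; set u := enorm z / s.
have u1 : 1 <= u by rewrite ler_pdivlMr // mul1r.
have rv : r <= enorm v by rewrite vr lerDl ltW.
have W : log_barrier al tau r y (x + z) - log_barrier al tau r y x <= al * (2 / beta * u `^ beta).
  apply: le_trans (log_barrier_increment_le al tau r y x z (ltW al0) tau0 rv) _.
  rewrite ler_wpM2l ?(ltW al0) //; apply: le_trans (ln1D_le_powR beta u _ u1); last by rewrite b0.
  have u3 : enorm z / (tau + d) <= u.
    by rewrite ler_wpM2l // lef_pV2 ?posrE // ltW // ltr_wpDl // ltW.
  rewrite ler_ln ?posrE ?lerD2l //; first by rewrite ltr_pwDl // divr_ge0 // ltW.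
  by rewrite ltr_pwDl.
have q0 : 0 <= u `^ beta by exact: powR_ge0.
have alq : 0 <= al * u `^ beta by rewrite mulr_ge0 // ltW.
rewrite /first_order_term; case: ifP => sig1.
  rewrite (_ : (sigma == 1) = false) ?mul0r ?subr0; last by rewrite lt_eqF.
  by apply: le_trans W _; lra.
case: ifP => sigE.
  (* For [|z| >= s = 2^-J] the shell and the unit cut-off agree, so the two linear terms cancel
     exactly. This is why [s] is a dyadic radius. *)
  have -> : \1_(dyadic_shell J) z = \1_(eball (0 : E) 1) z :> R.
    rewrite !indicE; congr (_%:R); congr nat_of_bool; apply/idP/idP => /set_mem h; apply/mem_set.
      by move: h; rewrite /dyadic_shell /eball /= subr0 => /andP[].
    by move: h; rewrite /dyadic_shell /eball /= subr0 -sJ sz.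
  rewrite (_ : \1_(eball 0 1) z * (p * dotv e z) = p * (dotv e z * \1_(eball 0 1) z)); last by ring.
  by rewrite lerD2r; apply: le_trans W _; lra.
rewrite mul0r subr0.
(* Above [sigma = 1] the linear term is not cut off at infinity, which dictates the far exponent
   1. *)
have be1 : beta = 1.
  by rewrite /far_exponent lt_neqAle eq_sym sigE /= leNgt sig1.
have : - (p * dotv e z) <= al * u `^ beta.
  rewrite {1}be1 powRr1 //; apply: le_trans psz; rewrite -mulrN ler_wpM2l ?(ltW p0) //.
  by rewrite lerNl; have := dotv_ge e z; rewrite e1 mul1r.
by move: W; lra.
Qed.

End BarrierProfile.

(** * Choice of the constants of one barrier *)

Section DriftOfBarrier.
Context {R : realType} {n : nat}.
Local Notation E := 'rV[R]_n.+1.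
Local Notation vol := (lebesgueRn R n).
Context {sigma lambda Lambda mu : R}.
Hypotheses (sigma_gt0 : 0 < sigma) (sigma_lt2 : sigma < 2).
Hypotheses (lambda_gt0 : 0 < lambda) (lambda_le : lambda <= Lambda) (mu_gt0 : 0 < mu).
Local Notation kernels := (@kernel_class R n sigma lambda Lambda mu).
Implicit Types (K phi : E -> R) (x y z e : E).

(** Without integrability the two bounds are not negatives of each other. The second bounds [Mminus]
    of [- phi] from below and serves the supersolution; the first bounds [Mplus] from above and
    serves the subsolution. *)
Definition drift_le phi x (b : R) := forall K, kernels K ->
  (\int[vol]_z (increment sigma phi x z * K z)%:E <= (- b)%:E)%E /\
  (b%:E <= \int[vol]_z (- increment sigma phi x z * K z)%:E)%E.

(** [d0] and [al] do not depend on [tau]: the weights live at a scale comparable to the distance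
    from the ball, and [tau] enters only through [tau + d >= d]. *)
Lemma barrier_profile (C0 C1 : R) : 0 <= C0 -> (sigma < 1 -> C0 = 0) -> 0 <= C1 ->
  forall ep r dm : R, 0 < ep -> 0 < r -> 0 < dm ->
  exists d0 al : R, [/\ 0 < d0, d0 <= dm, 0 < al &
    forall tau phi x y, 0 < tau -> C2b phi -> r < enorm (x - y) <= r + d0 ->
    (forall z, phi (x + z) - phi x <=
       log_barrier al tau r y (x + z) - log_barrier al tau r y x - ep * \1_(eball y r) (x + z)) ->
    drift_le phi x (C1 + C0 * enorm (grad phi x))].
Proof.
move=> C00 C0s C10 ep r dm ep0 r0 dm0.
have [b0 b1 bs] := far_exponent_bounds sigma_gt0 sigma_lt2.
have bint : 0 <= far_exponent (sigma := sigma) < sigma by rewrite (ltW b0).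
have [t t0 [c c0 [C C00' drift]]] := @drift_estimate R n sigma lambda Lambda mu sigma_gt0 sigma_lt2
  lambda_gt0 lambda_le mu_gt0 _ _ bint (near_exponent_gt sigma_lt2).
pose B : R := 2 / far_exponent (sigma := sigma) + 2.
have B0 : 0 <= B by rewrite addr_ge0 // divr_ge0 // ltW.
(* The ball will gain [Q d^-sigma]. One half pays for the logarithm and the gradient through the
   choice of [al], the other half for [C1] through [d1]. The 4 in [den] bounds [(d / s)^sigma], as
   [d <= 2 s] and [sigma < 2]. *)
pose kap : R := (2 / t) `^ (- sigma).
have kap0 : 0 < kap by rewrite powR_gt0 // divr_gt0.
pose Q : R := ep * c * kap.
have Q0 : 0 < Q by rewrite !mulr_gt0.
pose den : R := 4 * B * C + C0 + 1.
have den0 : 0 < den by rewrite ltr_wpDl // addr_ge0 // !mulr_ge0.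
pose al : R := Q / 2 / den.
have al0 : 0 < al by rewrite !divr_gt0.
have al_den : al * (4 * B * C + C0) <= Q / 2.
  have : al * den = Q / 2 by rewrite /al divfK // gt_eqF.
  by rewrite /den mulrDr mulr1; have := ltW al0; lra.
pose q : R := Q / (2 * (C1 + 1)).
have C11 : 0 < 2 * (C1 + 1) by rewrite mulr_gt0 // ltr_wpDl.
have q0 : 0 < q by rewrite divr_gt0.
(* For [d <= d1] one has [q d^-sigma >= 1], that is [C1 + 1 <= (Q / 2) d^-sigma]. *)
pose d1 : R := q `^ sigma^-1.
have d10 : 0 < d1 by rewrite powR_gt0.
(* Controls the curvature of the sphere: with [de = 2 d / t], the bound [d <= d2] means
   [4 de^2 <= 2 r d]. *)
pose d2 : R := r * t ^+ 2 / 8.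
have d20 : 0 < d2 by rewrite divr_gt0 // mulr_gt0 // exprn_gt0.
exists (Num.min (Num.min dm 1) (Num.min d1 d2)), al; split=> //.
- by rewrite !lt_min dm0 ltr01 d10 d20.
- by rewrite !ge_min lexx.
move=> tau phi x y tau0 C2phi /andP[rx]; rewrite -lerBlDl !le_min.
set v := x - y; set d := enorm v - r => /andP[/andP[_ dle1] /andP[dd1 dd2]] phi_le.
have d0 : 0 < d by rewrite subr_gt0.
have vp : 0 < enorm v by exact: lt_trans rx.
have v0 : v != 0 by apply: contraTneq vp => ->; rewrite enorm0 ltxx.
have td : 0 < tau + d by rewrite addr_gt0.
pose p := al / (tau + d).
have p0 : 0 < p by rewrite divr_gt0.
pose e := (enorm v)^-1 *: v.
have e1 : enorm e = 1 by rewrite enormZ ger0_norm ?invr_ge0 ?(ltW vp) // mulVf // gt_eqF.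
have ball0 z : 0 <= ep * \1_(eball y r) z by rewrite mulr_ge0 // ltW.
have gradE : grad phi x = p *: e.
  apply: (grad_touching phi x v p d) => //; first exact: ltW.
  move=> z zd; apply: le_trans (phi_le z) _; rewrite lerBlDr.
  apply: le_trans (log_barrier_increment_le_near al tau r y x z (ltW al0) tau0 (ltW zd)) _.
  by rewrite lerDl.
have gradn : enorm (grad phi x) = p by rewrite gradE enormZ e1 mulr1 ger0_norm // ltW.
(* Provides a dyadic [s] with [s < d <= 2 s]; [d <= 1] makes the exponent a natural number. *)
have [j /andP[j1 j2]] : exists j : nat, 2 ^+ j <= d^-1 < 2 ^+ j.+1.
  by apply: dyadic_floor; rewrite -invr1 lef_pV2 ?posrE.
pose s : R := 2^-1 ^+ j.+1.
have s0 : 0 < s by rewrite exprn_gt0 // invr_gt0.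
have pj k : 0 < 2 ^+ k :> R by rewrite exprn_gt0.
have sd : s < d by rewrite /s exprVn -[ltRHS]invrK ltf_pV2 ?posrE ?invr_gt0.
have ds : d <= 2 * s.
  rewrite /s exprS mulrA divff ?mul1r ?pnatr_eq0 // exprVn -[leLHS]invrK.
  by rewrite lef_pV2 ?posrE ?invr_gt0.
(* Then [e.z < - t de = - 2 d] reaches a depth [d] beyond the tangent plane of the ball. This margin
   outweighs the curvature: [|v + z|^2 < (r + d)^2 - 4 d (r + d) + 2 r d < r^2]. *)
pose de : R := 2 / t * d.
have de0 : 0 < de by rewrite mulr_gt0 // divr_gt0.
have tde : t * de = 2 * d by rewrite /de; field; rewrite gt_eqF.
have Dball z : (annulus de `&` [set z | dotv e z < - (t * de)]) z -> eball y r (x + z).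
  move=> [/annulusE /andP[_ zde]] /=; rewrite tde => ez.
  rewrite /eball /= addrAC -/v -(ltr_pXn2r (n := 2)) ?nnegrE ?enorm_ge0 ?(ltW r0) //.
  rewrite sqr_enormD.
  have -> : dotv v z = enorm v * dotv e z.
    by rewrite /e dotvZl mulrA divff ?mul1r // gt_eqF.
  have vE : enorm v = r + d by rewrite /d addrC subrK.
  have z2 : enorm z ^+ 2 <= 4 * de ^+ 2.
    rewrite (_ : 4 * de ^+ 2 = (2 * de) ^+ 2); last by ring.
    apply: lerXn2r (ltW zde); rewrite nnegrE; [exact: enorm_ge0|exact/mulr_ge0/ltW].
  have de2 : 4 * de ^+ 2 <= 2 * r * d.
    have -> : 4 * de ^+ 2 = (16 / t ^+ 2 * d) * d by rewrite /de; field; rewrite gt_eqF.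
    rewrite ler_wpM2r ?(ltW d0) // mulrAC ler_pdivrMr ?exprn_gt0 //.
    by move: dd2; rewrite /d2 ler_pdivlMr //; lra.
  have ez2 : enorm v * dotv e z <= enorm v * (- (2 * d)) by rewrite ler_wpM2l ?(ltW vp) // ltW.
  by move: ez2; rewrite vE; have := mulr_gt0 r0 d0; have := mulr_gt0 d0 d0; nra.
move=> K KK.
have mF := measurable_increment sigma phi x C2phi.
have [] := drift K (increment sigma phi x) (al * B) ep (if sigma == 1 then p else 0) s de j.+1 e
  KK mF _ (ltW ep0) s0 de0 e1 _ _.
- by rewrite mulr_ge0 // ltW.
- by case: eqP => [->|_]; [right|left].
- move=> z; rewrite (increment_first_order phi x z p e gradE).
  have lw : log_barrier al tau r y (x + z) - log_barrier al tau r y x -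
        first_order_term (sigma := sigma) p e z <=
      al * B * (near_weight (near_exponent (sigma := sigma)) s z +
                far_weight (far_exponent (sigma := sigma)) s z) -
      (if sigma == 1 then p else 0) * (dotv e z * \1_(dyadic_shell j.+1) z) :=
    log_barrier_weights sigma_gt0 sigma_lt2 al tau r y x s j.+1 z al0 tau0 r0 erefl sd.
  have ind : ep * \1_(annulus de `&` [set z | dotv e z < - (t * de)]) z <= ep * \1_(eball y r) (x + z).
    rewrite ler_wpM2l ?(ltW ep0) // !indicE ler_nat.
    by have [/set_mem/Dball Dz|//] := boolP (z \in _); rewrite mem_set.
  by have := phi_le z; move: lw ind; lra.
set w := al * B * _ - _ => h1 h2.
suff wle : w <= - (C1 + C0 * enorm (grad phi x)).
  split; first by apply: le_trans h1 _; rewrite lee_fin.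
  by apply: le_trans h2; rewrite lee_fin lerNr.
rewrite /w gradn.
pose D : R := d `^ (- sigma).
have dsig : 0 < d `^ sigma by exact: powR_gt0.
have D0 : 0 < D by exact: powR_gt0.
have SD : s `^ (- sigma) <= 4 * D.
  have h : d `^ sigma <= 4 * s `^ sigma.
    apply: (@le_trans _ _ ((2 * s) `^ sigma)).
      by apply: ge0_ler_powR; rewrite ?nnegrE ?mulr_ge0 ?(ltW sigma_gt0) ?(ltW d0) ?(ltW s0).
    rewrite powRM ?(ltW s0) // ler_wpM2r ?powR_ge0 //.
    rewrite (_ : 4 = 2 `^ 2%:R); last by rewrite powR_mulrn //; ring.
    by rewrite ler_powR ?ler1n // ltW.
  rewrite /D !powRN -[leRHS]invrK invfM invrK ler_pV2 ?inE ?unitf_gt0 ?divr_gt0 ?mulr_gt0 ?powR_gt0 //.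
  by rewrite mulrC ler_pdivrMr // mulrC.
have deD : de `^ (- sigma) = kap * D by rewrite /de powRM ?divr_ge0 ?(ltW t0) ?(ltW d0).
(* The gradient has size at most [al / d], and [d^-1 <= d^-sigma] when [d <= 1] and [sigma >= 1];
   for [sigma < 1] the coefficient [C0] is 0. *)
have pD : C0 * p <= C0 * (al * D).
  have [/C0s ->|s1] := ltP sigma 1; first by rewrite !mul0r.
  rewrite ler_wpM2l // /p ler_wpM2l ?(ltW al0) //.
  apply: (@le_trans _ _ d^-1); first by rewrite lef_pV2 ?posrE // lerDr ltW.
  rewrite /D powRN lef_pV2 ?posrE // -[leRHS]powRr1 ?(ltW d0) //.
  by apply: ger_powR; rewrite ?d0.
have qD : 1 <= q * D.
  rewrite /D powRN ler_pdivlMr // mul1r -[leRHS]powRr1 ?(ltW q0) //.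
  rewrite -(mulVf (lt0r_neq0 sigma_gt0)) powRrM -/d1.
  by apply: ge0_ler_powR; rewrite ?nnegrE ?(ltW sigma_gt0) ?(ltW d0) ?(ltW d10).
have QE : q * (2 * (C1 + 1)) = Q by rewrite /q divfK // gt_eqF.
have C1D : C1 <= Q / 2 * D.
  rewrite -QE (_ : _ / 2 * D = (C1 + 1) * (q * D)); last by field.
  by apply: (@le_trans _ _ ((C1 + 1) * 1)); [lra|rewrite ler_wpM2l // addr_ge0].
have BC0 : 0 <= al * B * C by apply: mulr_ge0 => //; apply: mulr_ge0 => //; exact: ltW.
have := ler_wpM2l BC0 SD; have := ler_wpM2r (ltW D0) al_den.
have -> : ep * (c * de `^ (- sigma)) = Q * D by rewrite deD /Q; ring.
by move: C1D pD; lra.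
Qed.

End DriftOfBarrier.

(** * Drift at a global maximum *)

Section MaximumDrift.
Context {R : realType} {n : nat}.
Local Notation E := 'rV[R]_n.+1.
Local Notation vol := (lebesgueRn R n).
Context {sigma lambda Lambda mu : R}.
Hypotheses (sigma_gt0 : 0 < sigma) (sigma_lt2 : sigma < 2).
Hypotheses (lambda_gt0 : 0 < lambda) (lambda_le : lambda <= Lambda) (mu_gt0 : 0 < mu).
Local Notation kernels := (@kernel_class R n sigma lambda Lambda mu).

(** At a global maximum the gradient vanishes and no increment is positive, so one annulus of kernel
    mass at least [k] with drop [C1 / k + 1] is enough. This drop is known before any barrier is
    built. *)
Lemma max_drift (C0 C1 d : R) : 0 <= C1 -> 0 < d -> exists2 m, 0 < m &
  forall (phi : E -> R) x, C2b phi -> (forall z, phi (x + z) <= phi x) ->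
    (forall z, annulus d z -> phi (x + z) <= phi x - m) ->
    drift_le (sigma := sigma) (lambda := lambda) (Lambda := Lambda) (mu := mu)
      phi x (C1 + C0 * enorm (grad phi x)).
Proof.
move=> C10 d0.
have [c c0 mass] := @kernel_annulus_mass R n sigma lambda Lambda mu sigma_lt2 lambda_gt0 mu_gt0.
pose k : R := c * d `^ (- sigma).
have k0 : 0 < k by rewrite mulr_gt0 // powR_gt0.
exists (C1 / k + 1); first by rewrite ltr_wpDl // divr_ge0 // ltW.
set m := C1 / k + 1; have m0 : 0 <= m by rewrite addr_ge0 // divr_ge0 // ltW.
move=> phi x C2phi phi_max phi_ann.
have grad0 : grad phi x = 0.
  apply/rowP => i; rewrite !mxE; apply: (partial_touching phi x i 0 0 1) => //.
    by have [/(_ i) [+ _] _] := C2phi; apply.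
  by move=> t _; rewrite !mul0r addr0 subr_le0.
have incE z : increment sigma phi x z = phi (x + z) - phi x.
  rewrite /increment grad0 dotvC dotv0r mulr0 !subr0.
  by case: (sigma < 1) => //; case: (sigma == 1).
rewrite grad0 enorm0 mulr0 addr0 => K KK.
have K0 z := kernel_ge0 K z KK.
have mI := measurable_increment sigma phi x C2phi.
have mIK := measurable_mul_kernel K _ KK mI.
have mNI : measurable_fun setT ((fun z => - increment sigma phi x z) : Rn R n -> R).
  exact: measurableT_comp mI.
have mNIK := measurable_mul_kernel K _ KK mNI.
have iA := kernel_annulus_integrable K d KK d0.
pose h z := ((- m)%:E * (\1_(annulus d) z * K z)%:E)%E.
have ih : vol.-integrable setT h by exact: integrableZl.
have hle z : ((increment sigma phi x z * K z)%:E <= h z)%E.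
  rewrite /h -EFinM lee_fin mulrA ler_wpM2r // incE indicE.
  have [/set_mem az|_] := boolP (z \in annulus d).
    by rewrite mulr1 lerBlDl; exact: phi_ann.
  by rewrite mulr0 subr_le0.
have hint : (\int[vol]_z h z <= (- C1)%:E)%E.
  rewrite (integralZl measurableT iA).
  have : (k%:E <= \int[vol]_z (\1_(annulus d) z * K z)%:E)%E.
    apply: le_trans (mass K d KK d0) _; rewrite integral_mul_indic le_eqVlt.
    by apply/orP; left; apply/eqP/eq_integral => z _; rewrite mulrC.
  rewrite -(fineK (integrable_fin_num measurableT iA)); move: (fine _) => a.
  rewrite -EFinM !lee_fin => ka.
  have : m * k <= m * a by rewrite ler_wpM2l.
  have : m * k = C1 + k by rewrite /m mulrDl mul1r divfK // gt_eqF.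
  by lra.
have mh : measurable_fun setT (h : Rn R n -> \bar R) by case/integrableP: ih.
split.
  by apply: le_trans hint; apply: measurable_le_integral.
rewrite -[C1]opprK EFinN leeNl; apply: le_trans hint.
rewrite leeNl -integralN ?integrable_add_def //.
apply: measurable_le_integral.
- by case/integrableP: (integrableN ih).
- exact: mNIK.
- by move=> z; rewrite mulNr EFinN leeN2.
Qed.

End MaximumDrift.

(** * Compact sets and uniform continuity in the Euclidean norm *)

Section Compactness.
Context {R : realType} {n : nat}.
Local Notation E := 'rV[R]_n.+1.
Implicit Types (x y : E).

Lemma compact_enorm_le (B : R) (A : set E) : closed A ->
  (forall y, A y -> enorm y <= B) -> compact A.
Proof.
move=> Acl AB; apply: bounded_closed_compact => //.
exists B; split; first exact: num_real.
move=> m Bm y Ay; apply: le_trans (norm_le_enorm y) _.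
by apply: le_trans (AB y Ay) (ltW Bm).
Qed.

Lemma closed_enorm_le (y : E) (B : R) : closed [set x | enorm (x - y) <= B].
Proof.
rewrite -openC openE => x /= /negP; rewrite -ltNge => Bx.
apply/nbhs_enormP; exists (enorm (x - y) - B); first by rewrite subr_gt0.
move=> z zx /=; apply/negP; rewrite -ltNge.
by have := enormBD x z y; rewrite (enorm_distC x z); move: zx; lra.
Qed.

Lemma closed_enorm_ge (y : E) (B : R) : closed [set x | B <= enorm (y - x)].
Proof.
rewrite -openC openE => x /= /negP; rewrite -ltNge => Bx.
apply/nbhs_enormP; exists (B - enorm (y - x)); first by rewrite subr_gt0.
move=> z zx /=; apply/negP; rewrite -ltNge.
by have := enormBD y x z; rewrite (enorm_distC x z); move: zx; lra.
Qed.

(** Only [y] is confined to the ball; compactness is applied to the property of [y] quantified over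
    all nearby [x]. *)
Lemma bounded_uniform_continuous (g : E -> R) (B ep : R) : continuous g -> 0 < ep ->
  exists2 d, 0 < d & forall x y, enorm y <= B -> enorm (x - y) < d -> `|g x - g y| <= ep.
Proof.
move=> cg ep0.
have cA : compact [set y : E | enorm y <= B].
  apply: (@compact_enorm_le B) => //.
  by have := closed_enorm_le 0 B; under [X in closed X]eq_set do rewrite subr0.
pose P (d : R) y := forall x, enorm (x - y) < d -> `|g x - g y| <= ep.
have [d [dP d0]] : exists d, (forall y, enorm y <= B -> P d y) /\ 0 < d.
  have : \forall d \near 0^'+, forall y, [set y : E | enorm y <= B] y -> P d y.
    move/compact_near_coveringP: cA; apply => y _.
    have ep20 : 0 < ep / 2 by rewrite divr_gt0.
    have /continuous_at_enormP/(_ _ ep20) [d d0 dg] := cg y.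
    have d20 : 0 < d / 2 by rewrite divr_gt0.
    exists ([set y' | enorm (y' - y) < d / 2], [set d' | d' < d / 2]).
      split; last exact: nbhs_right_lt.
      by apply/nbhs_enormP; exists (d / 2).
    move=> [y' d'] [/= y'd d'd] x xy'.
    have xy : enorm (x - y) < d by have := enormBD x y' y; lra.
    have y'y : enorm (y' - y) < d by lra.
    have := dg x xy; have := dg y' y'y; rewrite distrC => h1 h2.
    have -> : g x - g y' = - (g y - g x) - (g y' - g y) by ring.
    rewrite (le_trans (ler_normB _ _)) // normrN; lra.
  move=> dP; have d0 := @nbhs_right_gt R 0.
  have [d [? ?]] := @filter_ex _ 0^'+ (at_right_proper_filter (0 : R)) _ (filterI dP d0).
  by exists d.
exists d => // x y yB; exact: dP.
Qed.

End Compactness.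

(** * The infimum of the barrier family *)

Section BarrierFamily.
Context {R : realType} {n : nat}.
Local Notation E := 'rV[R]_n.+1.
Context (Omega : set E) (g : E -> R) (G M Rd : R) (ep r d0 al tau : nat -> R).
Hypotheses (openO : open Omega) (boundO : forall x, Omega x -> enorm x < Rd).
Hypotheses (cont_g : continuous g) (bound_g : forall x, `|g x| <= G) (GM : G <= M).
Hypotheses (ep_gt0 : forall k, 0 < ep k) (r_gt0 : forall k, 0 < r k).
Hypotheses (d0_gt0 : forall k, 0 < d0 k) (d0_le : forall k, d0 k <= r k).
Hypotheses (al_gt0 : forall k, 0 < al k) (tau_gt0 : forall k, 0 < tau k).
Hypothesis g_osc : forall k x y, enorm y <= Rd + 1 -> enorm (x - y) <= 2 * r k ->
  `|g x - g y| <= ep k.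
Hypothesis height : forall k, M + G <= al k * ln (1 + d0 k / tau k).
Hypothesis d0_cvg0 : forall e, 0 < e -> exists N, forall k, (N <= k)%N -> d0 k < e.
Hypothesis exterior_ball : forall x e, closure Omega x -> ~ Omega x -> 0 < e ->
  exists k y, [/\ ep k < e, enorm y <= Rd + 1, enorm (x - y) <= r k &
    forall z, Omega z -> r k <= enorm (z - y)].
Implicit Types (x y z : E) (k : nat).

(** All balls missing [Omega] are taken, not only those touching it, because this condition is
    closed in the center; the bound on the center then gives compactness. *)
Definition exterior_centers k : set E :=
  [set y | enorm y <= Rd + 1 /\ forall z, Omega z -> r k <= enorm (z - y)].

Definition barrier_branch k y x : R :=
  g y + 2 * ep k + log_barrier (al k) (tau k) (r k) y x.

Definition barrier_values x : set R :=
  [set v | v = M \/ exists k y, exterior_centers k y /\ v = barrier_branch k y x].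

Definition barrier x : R := if x \in Omega then inf (barrier_values x) else g x.

Let log_ge0 k y x : 0 <= log_barrier (al k) (tau k) (r k) y x.
Proof. exact/log_barrier_ge0/tau_gt0/ltW. Qed.

Let g_ge x : - G <= g x.
Proof. by have := bound_g x; rewrite ler_norml => /andP[]. Qed.

Let g_le x : g x <= G.
Proof. by have := bound_g x; rewrite ler_norml => /andP[]. Qed.

Lemma branch_far k y x : r k + d0 k <= enorm (x - y) -> M <= barrier_branch k y x.
Proof.
move=> far; have h : M + G <= log_barrier (al k) (tau k) (r k) y x.
  apply: le_trans (height k) _; rewrite ler_wpM2l ?(ltW (al_gt0 k)) //.
  have dt : 0 < d0 k / tau k by rewrite divr_gt0.
  have le1 : d0 k / tau k <= Num.max 0 (enorm (x - y) - r k) / tau k.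
    by rewrite ler_pM2r ?invr_gt0 // le_max; apply/orP; right; rewrite lerBrDl.
  by rewrite ler_ln ?posrE ?lerD2l // addr_gt0 // (lt_le_trans dt).
by have := g_ge y; have := ep_gt0 k; rewrite /barrier_branch; lra.
Qed.

(** Of the two [ep k] in a branch, one absorbs the oscillation of [g]; the other survives as the
    drop seen inside the ball. *)
Lemma branch_near k y x : enorm y <= Rd + 1 -> enorm (x - y) <= 2 * r k ->
  g x + ep k <= barrier_branch k y x.
Proof.
move=> yR xy; have := g_osc k x y yR xy; rewrite ler_norml => /andP[_ h].
by have := log_ge0 k y x; rewrite /barrier_branch; lra.
Qed.

(** Within [2 r k] of the center the oscillation bound applies; farther away [d0 k <= r k] puts the
    point where the branch has reached [M]. *)
Lemma branch_ge k y x : enorm y <= Rd + 1 -> g x <= barrier_branch k y x.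
Proof.
move=> yR; have [xy|xy] := leP (enorm (x - y)) (2 * r k).
  by have := branch_near k y x yR xy; have := ep_gt0 k; lra.
apply: le_trans (le_trans (g_le x) GM) (branch_far k y x _).
by have := d0_le k; lra.
Qed.

Lemma values_ge x v : barrier_values x v -> g x <= v.
Proof.
move=> [->|[k [y [[yR _] ->]]]]; last exact: branch_ge.
exact: le_trans (g_le x) GM.
Qed.

Lemma values_has_inf x : has_inf (barrier_values x).
Proof. by split; [exists M; left|exists (g x) => v; exact: values_ge]. Qed.

Lemma barrier_in_le x v : Omega x -> barrier_values x v -> barrier x <= v.
Proof.
move=> Ox xv; rewrite /barrier mem_set //; apply: ge_inf => //.
by have [] := values_has_inf x.
Qed.

Lemma barrier_ge x : g x <= barrier x.
Proof.
rewrite /barrier; case: ifP => // _; apply: lb_le_inf.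
  by have [] := values_has_inf x.
by move=> v; exact: values_ge.
Qed.

Lemma barrier_le x : barrier x <= M.
Proof.
have [Ox|nOx] := pselect (Omega x); first by apply: barrier_in_le => //; left.
by rewrite /barrier memNset //; exact: le_trans (g_le x) GM.
Qed.

Lemma barrier_out x : ~ Omega x -> barrier x = g x.
Proof. by move=> nOx; rewrite /barrier memNset. Qed.

Lemma barrier_le_branch k y x : exterior_centers k y -> barrier x <= barrier_branch k y x.
Proof.
move=> ky; have [Ox|nOx] := pselect (Omega x).
  by apply: barrier_in_le => //; right; exists k, y.
by rewrite barrier_out //; case: ky => yR _; exact: branch_ge.
Qed.

(** Points of the ball lie outside [Omega], where the barrier is just [g]. This gap is the source of
    the negative drift. *)
Lemma barrier_lt_branch k y x : exterior_centers k y -> enorm (x - y) < r k ->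
  barrier x <= barrier_branch k y x - ep k.
Proof.
move=> [yR yO] xy; have nOx : ~ Omega x by move=> /yO; rewrite leNgt xy.
rewrite barrier_out // lerBrDr; apply: branch_near => //.
by have := r_gt0 k; lra.
Qed.

(** Moving from [x] by [e] towards [y] stays in [Omega], and the endpoint is still at distance at
    least [r k] from [y]. Hence a branch with [d0 k <= e] cannot be below [M] at [x]. *)
Lemma exterior_center_dist k y x e : exterior_centers k y -> 0 < e ->
  (forall z, enorm (z - x) < 2 * e -> Omega z) -> r k + e <= enorm (x - y).
Proof.
move=> [yR yO] e0 ball_x.
have [xy|xy] := leP (enorm (x - y)) e.
  have : Omega y by apply: ball_x; rewrite enorm_distC; lra.
  by move=> /yO; rewrite subrr enorm0; have := r_gt0 k; lra.
have xy0 : 0 < enorm (x - y) by lra.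
pose t := e / enorm (x - y).
have t0 : 0 <= t by rewrite divr_ge0 ?enorm_ge0 // ltW.
have t1 : t <= 1 by rewrite ler_pdivrMr // mul1r ltW.
have tE : t * enorm (x - y) = e by rewrite divfK // gt_eqF.
have /yO : Omega (x - t *: (x - y)).
  apply: ball_x; rewrite addrAC subrr add0r enormN enormZ ger0_norm // tE; lra.
rewrite addrAC -{1}(scale1r (x - y)) -scalerBl enormZ ger0_norm ?subr_ge0 //.
by rewrite mulrBl mul1r tE; lra.
Qed.

Lemma continuous_branch_center k x : continuous (fun y => barrier_branch k y x).
Proof.
move=> y; apply/continuous_at_enormP => e e0.
have e20 : 0 < e / 2 by rewrite divr_gt0.
have at0 : 0 < al k / tau k by rewrite divr_gt0.
have /continuous_at_enormP/(_ _ e20) [d dpos dg] := cont_g y.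
exists (Num.min d (e / 2 / (al k / tau k))); first by rewrite lt_min dpos !divr_gt0.
move=> y'; rewrite lt_min => /andP[/dg h1]; rewrite ltr_pdivlMr // => h2.
rewrite /barrier_branch.
have -> (a b c d1 d2 : R) : a + c + d1 - (b + c + d2) = (a - b) + (d1 - d2) by ring.
apply: le_lt_trans (ler_normD _ _) _; rewrite [ltRHS](splitr e); apply: ltrD => //.
have := log_barrier_lipschitz (al k) (tau k) (r k) y x y' x (ltW (al_gt0 k)) (tau_gt0 k).
move=> /le_lt_trans; apply; apply: le_lt_trans h2.
rewrite mulrC ler_wpM2r ?(ltW at0) //.
rewrite ler_norml; apply/andP; split.
  have := enormBD x y y'; have := enorm_subl (x - y') (x - y).
  rewrite (_ : x - y' - (x - y) = - (y' - y)); last by apply/rowP => i; rewrite !mxE; ring.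
  by rewrite enormN; lra.
have := enorm_subl (x - y) (x - y').
rewrite (_ : x - y - (x - y') = y' - y); last by apply/rowP => i; rewrite !mxE; ring.
by [].
Qed.

Lemma branch_lipschitz k y x x' :
  `|barrier_branch k y x - barrier_branch k y x'| <= al k / tau k * enorm (x - x').
Proof.
have -> : barrier_branch k y x - barrier_branch k y x' =
    log_barrier (al k) (tau k) (r k) y x - log_barrier (al k) (tau k) (r k) y x'.
  by rewrite /barrier_branch; ring.
apply: le_trans (log_barrier_lipschitz (al k) (tau k) (r k) y x y x' (ltW (al_gt0 k)) (tau_gt0 k)) _.
have at0 : 0 <= al k / tau k by rewrite divr_ge0 // ltW.
have xx' : x - y - (x' - y) = x - x' by rewrite opprB addrA subrK.
rewrite ler_wpM2l // ler_norml lerNl opprB -{1}xx' (le_trans (enorm_subl _ _)) /=.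
  by rewrite -xx' enorm_subl.
by rewrite -enormN opprB.
Qed.

Lemma compact_exterior_centers k : compact (exterior_centers k).
Proof.
apply: (@compact_enorm_le _ _ (Rd + 1)) => [|y [] //].
rewrite (_ : exterior_centers k = [set y | enorm (y - 0) <= Rd + 1] `&`
    \bigcap_(z in Omega) [set y | r k <= enorm (z - y)]).
  apply: closedI; first exact: closed_enorm_le.
  by apply: closed_bigI => z _; exact: closed_enorm_ge.
by apply/seteqP; split=> y /=; rewrite subr0.
Qed.

(** One compact set of centers is added per step. Starting from [M] covers scales at which no center
    exists. *)
Lemma branch_min (N : nat) x : exists v, [/\ barrier_values x v, v <= M,
    (v = M \/ exists k y, [/\ (k < N)%N, exterior_centers k y & v = barrier_branch k y x]) &
    forall k y, (k < N)%N -> exterior_centers k y -> v <= barrier_branch k y x].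
Proof.
elim: N => [|N [v [xv vM vE vmin]]]; first by exists M; split=> //; left.
have vE' : v = M \/ exists k y, [/\ (k < N.+1)%N, exterior_centers k y & v = barrier_branch k y x].
  by case: vE => [->|[k [y [kN ky vk]]]]; [left|right; exists k, y; rewrite ltnS ltnW].
have [/set0P ne|/negP/negPn/eqP e0] := pselect (exterior_centers N != set0); last first.
  exists v; split=> // k y; rewrite ltnS leq_eqVlt => /orP[/eqP ->|]; last exact: vmin.
  by rewrite e0.
have cb : {within exterior_centers N, continuous (fun y => barrier_branch N y x)}.
  exact/continuous_subspaceT/continuous_branch_center.
have [c /set_mem cN cmin] := EVT_min_rV ne (compact_exterior_centers N) cb.
have [vc|cv] := leP v (barrier_branch N c x).
  exists v; split=> // k y; rewrite ltnS leq_eqVlt => /orP[/eqP ->|]; last exact: vmin.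
  by move=> yN; apply: le_trans vc (cmin y (mem_set yN)).
exists (barrier_branch N c x); split.
- by right; exists N, c.
- exact: le_trans (ltW cv) vM.
- by right; exists N, c.
- move=> k y; rewrite ltnS leq_eqVlt => /orP[/eqP ->|kN ky]; first by move=> /mem_set; exact: cmin.
  exact: le_trans (ltW cv) (vmin k y kN ky).
Qed.

Lemma barrier_locally_finite x0 : Omega x0 -> exists e N, 0 < e /\
  forall x, enorm (x - x0) < e -> Omega x /\
    (barrier x = M \/
     exists k y, [/\ (k < N)%N, exterior_centers k y & barrier x = barrier_branch k y x]).
Proof.
move=> Ox0; have /nbhs_enormP [d dpos dO] : nbhs x0 Omega by exact: open_nbhs_nbhs.
(* A third, so that the ball of radius [2 e] around each point of the [e]-ball at [x0] stays in
   [Omega]. *)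
pose e := d / 3.
have e0 : 0 < e by rewrite divr_gt0.
have [N NP] := d0_cvg0 e e0.
exists e, N; split=> // x xx0.
have ball_x z : enorm (z - x) < 2 * e -> Omega z.
  by move=> zx; apply: dO; have := enormBD z x x0; move: zx xx0; rewrite /e; lra.
have Ox : Omega x by apply: dO; apply: lt_trans xx0 _; rewrite /e; lra.
split=> //.
have [v [xv vM vE vmin]] := branch_min N x.
suff -> : barrier x = v by [].
apply/eqP; rewrite eq_le barrier_in_le //= /barrier mem_set //.
apply: lb_le_inf; first by have [] := values_has_inf x.
move=> w [->//|[k [y [ky ->]]]].
have [kN|Nk] := ltnP k N; first exact: vmin.
apply: le_trans vM (branch_far k y x _).
apply: le_trans (exterior_center_dist k y x e ky e0 ball_x).
by rewrite lerD2l ltW // NP.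
Qed.

(** Inside, finitely many scales share the Lipschitz constant [L]. At a boundary point the barrier
    is squeezed between [g] and the branch of one exterior ball, which there exceeds [g x0] by at
    most [3 ep k]. *)
Lemma barrier_continuous : continuous barrier.
Proof.
suff main (x0 : E) (e : R) : 0 < e -> exists2 d, 0 < d &
    forall x : E, enorm (x - x0) < d -> `|barrier x0 - barrier x| < e.
  by move=> x; apply/continuous_at_enormP => e; exact: main.
move=> e0.
have [Ox0|nOx0] := pselect (Omega x0).
  have [d [N [dpos dP]]] := barrier_locally_finite x0 Ox0.
  pose L : R := \sum_(k < N) al k / tau k.
  have at0 k : 0 <= al k / tau k by rewrite divr_ge0 // ltW.
  have L0 : 0 <= L by apply: sumr_ge0 => k _.
  have lip x x' : enorm (x - x0) < d -> barrier x' <= barrier x + L * enorm (x - x').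
    move=> xx0; have [Ox [->|[k [y [kN ky ->]]]]] := dP x xx0.
      by apply: le_trans (barrier_le x') _; rewrite lerDl mulr_ge0 // enorm_ge0.
    apply: le_trans (barrier_le_branch k y x' ky) _.
    have := branch_lipschitz k y x x'; rewrite ler_norml => /andP[h _].
    have : al k / tau k * enorm (x - x') <= L * enorm (x - x').
      rewrite ler_wpM2r ?enorm_ge0 // /L (bigD1 (Ordinal kN)) //= lerDl.
      by apply: sumr_ge0 => j _.
    by move: h; lra.
  have L1 : 0 < L + 1 by rewrite ltr_wpDl.
  exists (Num.min d (e / (L + 1))); first by rewrite lt_min dpos divr_gt0.
  move=> x; rewrite lt_min => /andP[xd]; rewrite ltr_pdivlMr // => xe.
  have x0d : enorm (x0 - x0) < d by rewrite subrr enorm0.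
  have := lip x x0 xd; have := lip x0 x x0d; rewrite (enorm_distC x0 x) => h1 h2.
  have xx := enorm_ge0 (x - x0).
  have le : L * enorm (x - x0) < e.
    by apply: le_lt_trans xe; rewrite mulrC ler_wpM2l // lerDl.
  by rewrite ltr_norml; apply/andP; split; lra.
have /continuous_at_enormP/(_ e e0) [d1 d10 dg] := cont_g x0.
have [clx0|nclx0] := pselect (closure Omega x0); last first.
  have /nbhs_enormP [d2 d20 d2P] : nbhs x0 (~` closure Omega).
    by apply: open_nbhs_nbhs; split=> //; rewrite openC; exact: closed_closure.
  exists (Num.min d1 d2); first by rewrite lt_min d10.
  move=> x; rewrite lt_min => /andP[xd1 xd2].
  rewrite !barrier_out //; first exact: dg.
  by move=> /(@subset_closure _ Omega x); exact: d2P.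
(* Three quarters of [e] pay for the excess [3 ep k] of the branch at [x0], the last one for its
   variation near [x0]. *)
have e4 : 0 < e / 4 by rewrite divr_gt0.
have [k [y [epk yR x0y yO]]] := exterior_ball x0 (e / 4) clx0 nOx0 e4.
have ky : exterior_centers k y by [].
have gy : g y <= g x0 + ep k.
  have : enorm (x0 - y) <= 2 * r k by have := r_gt0 k; lra.
  by move=> /(g_osc k x0 y yR); rewrite ler_norml => /andP[h _]; lra.
have bx0 : barrier_branch k y x0 = g y + 2 * ep k.
  by rewrite /barrier_branch log_barrier_eq0 ?addr0.
have at0 : 0 < al k / tau k by rewrite divr_gt0.
exists (Num.min d1 (e / 4 / (al k / tau k))); first by rewrite lt_min d10 !divr_gt0.
move=> x; rewrite lt_min => /andP[xd1]; rewrite ltr_pdivlMr // => xe.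
rewrite (barrier_out x0) //.
have := dg x xd1; have := barrier_ge x; rewrite !ltr_norml => h1 /andP[h2 h3].
have := barrier_le_branch k y x ky.
have := branch_lipschitz k y x0 x; rewrite bx0 enorm_distC ler_norml => /andP[h4 _] h5.
have [Ox|nOx] := pselect (Omega x); last first.
  by rewrite barrier_out // h2 h3.
by apply/andP; split; move: xe h4 h5; rewrite mulrC; lra.
Qed.

(** [P] stands for the drift estimate, which separates the geometry of the infimum from the
    integrals. A function touching the infimum from below also touches the branch that attains
    it. *)
Lemma barrier_touching (P : (E -> R) -> E -> Prop) :
  (forall k phi x y, C2b phi -> r k < enorm (x - y) <= r k + d0 k ->
    (forall z, phi (x + z) - phi x <=
       log_barrier (al k) (tau k) (r k) y (x + z) - log_barrier (al k) (tau k) (r k) y x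
       - ep k * \1_(eball y (r k)) (x + z)) -> P phi x) ->
  (forall phi x, C2b phi -> (forall z, phi (x + z) <= phi x) ->
    (forall z, annulus (2 * Rd) z -> phi (x + z) <= phi x - (M - G)) -> P phi x) ->
  forall x phi, Omega x -> C2b phi ->
    (forall y, barrier x - phi x <= barrier y - phi y) -> P phi x.
Proof.
move=> Pbranch Pmax x phi Ox C2phi touch.
have inc z : phi (x + z) - phi x <= barrier (x + z) - barrier x.
  by have := touch (x + z); lra.
have [xM|xM] := eqVneq (barrier x) M.
  apply: Pmax => // z.
    by have := inc z; have := barrier_le (x + z); lra.
  (* Since [|x| < Rd] and [|z| >= 2 Rd], the point [x + z] has left [Omega], where the barrier is at
     most [G]. *)
  move=> /annulusE /andP[zR _].
  have nO : ~ Omega (x + z).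
    move=> /boundO; have := boundO x Ox; have := enorm_subl z (- x).
    by rewrite enormN opprK (addrC z); lra.
  by have := inc z; rewrite barrier_out //; have := g_le (x + z); lra.
have [d [N [dpos dP]]] := barrier_locally_finite x Ox.
have [_] : Omega x /\ (barrier x = M \/
     exists k y, [/\ (k < N)%N, exterior_centers k y & barrier x = barrier_branch k y x]).
  by apply: dP; rewrite subrr enorm0.
case=> [/eqP|[k [y [_ ky xE]]]]; first by rewrite (negbTE xM).
have ltM : barrier_branch k y x < M by rewrite -xE lt_neqAle xM barrier_le.
apply: (Pbranch k phi x y) => //.
  apply/andP; split; last by rewrite leNgt; apply/negP => /ltW/(branch_far k y x); rewrite leNgt ltM.
  have d20 : 0 < d / 2 by rewrite divr_gt0.
  have ball_x z : enorm (z - x) < 2 * (d / 2) -> Omega z.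
    by move=> zx; apply: (dP z _).1; lra.
  by have := exterior_center_dist k y x (d / 2) ky d20 ball_x; lra.
move=> z; apply: le_trans (inc z) _; rewrite xE.
have [xzy|xzy] := boolP (x + z \in eball y (r k)).
  have := barrier_lt_branch k y (x + z) ky (set_mem xzy).
  by rewrite indicE xzy mulr1 /barrier_branch; lra.
have := barrier_le_branch k y (x + z) ky.
by rewrite indicE (negbTE xzy) mulr0 /barrier_branch; lra.
Qed.

End BarrierFamily.

(** * Choice of the parameters at all scales *)

Section BarrierExistence.
Context {R : realType} {n : nat}.
Local Notation E := 'rV[R]_n.+1.
Context {sigma lambda Lambda mu : R}.
Hypotheses (sigma_gt0 : 0 < sigma) (sigma_lt2 : sigma < 2).
Hypotheses (lambda_gt0 : 0 < lambda) (lambda_le : lambda <= Lambda) (mu_gt0 : 0 < mu).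

Lemma bounded_enorm_lt (A : set E) : bounded_set A ->
  exists2 B : R, 0 < B & forall x, A x -> enorm x < B.
Proof.
move=> [M [_ MA]].
have N0 : 0 < n.+1%:R :> R by [].
exists (n.+1%:R * (`|M| + 1) + 1); first by rewrite ltr_wpDl // mulr_ge0 // addr_ge0.
move=> x Ax; rewrite ltr_pwDr //; apply: le_trans (enorm_le_norm x) _.
rewrite ler_wpM2l //; apply: (MA (`|M| + 1)) => //.
by rewrite ltr_pwDr // ler_norm.
Qed.

Lemma closure_enorm_le (A : set E) (B : R) : (forall x, A x -> enorm x < B) ->
  forall x, closure A x -> enorm x <= B.
Proof.
move=> AB x clx; apply/ler_addgt0Pr => e e0.
have [z [Az zx]] : (A `&` eball x e) !=set0.
  by apply: clx; apply/nbhs_enormP; exists e.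
by have := AB z Az; have := enorm_subl x z; rewrite enorm_distC; move: zx; rewrite /eball /=; lra.
Qed.

Lemma barrier_exists (Omega : set E) (g : E -> R) (G C0 C1 : R) :
  open Omega -> bounded_set Omega -> uniform_exterior_ball Omega ->
  continuous g -> (forall x, `|g x| <= G) ->
  0 <= C0 -> (sigma < 1 -> C0 = 0) -> 0 <= C1 ->
  exists u : E -> R, [/\ continuous u, bounded_fun u, (forall x, g x <= u x),
    (forall x, ~ Omega x -> u x = g x) &
    forall x phi, Omega x -> C2b phi ->
      (forall y, u x - phi x <= u y - phi y) ->
      drift_le (sigma := sigma) (lambda := lambda) (Lambda := Lambda) (mu := mu)
        phi x (C1 + C0 * enorm (grad phi x))].
Proof.
move=> openO boundO [rO rO0 ballO] cg gG C00 C0s C10.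
have [Rd Rd0 ORd] := bounded_enorm_lt Omega boundO.
have Rd20 : 0 < 2 * Rd by rewrite mulr_gt0.
have [m m0 maxd] := @max_drift R n sigma lambda Lambda mu sigma_lt2 lambda_gt0 mu_gt0
  C0 C1 (2 * Rd) C10 Rd20.
have profile := @barrier_profile R n sigma lambda Lambda mu sigma_gt0 sigma_lt2
  lambda_gt0 lambda_le mu_gt0 C0 C1 C00 C0s C10.
pose M := G + m.
pose ep (k : nat) : R := k.+1%:R^-1.
have ep0 k : 0 < ep k by rewrite invr_gt0.
pose rad k (r : R) := [/\ 0 < r, r <= 1, r <= rO &
    forall x y : E, enorm y <= Rd + 1 -> enorm (x - y) <= 2 * r -> `|g x - g y| <= ep k].
have [r rP] : {r : nat -> R & forall k, rad k (r k)}.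
  apply: choice.
  move=> k; have [d d0 dP] := bounded_uniform_continuous g (Rd + 1) (ep k) cg (ep0 k).
  (* The bound 1 keeps the relevant centers within [Rd + 1], [rO] allows the exterior ball
     condition, and [d / 3] makes [2 r < d]. *)
  exists (Num.min (Num.min 1 rO) (d / 3)); split.
  - by rewrite !lt_min ltr01 rO0 divr_gt0.
  - by rewrite !ge_min lexx.
  - by rewrite !ge_min lexx orbT.
  - move=> x y yR xy; apply: dP => //; apply: le_lt_trans xy _.
    have : Num.min (Num.min 1 rO) (d / 3) <= d / 3 by rewrite ge_min lexx orbT.
    by move: (Num.min _ _) => q; lra.
have r0 k : 0 < r k by have [] := rP k.
(* The width [d0 k] is capped by [r k] so that oscillation bound and height overlap, and by [ep k]
   so that it tends to 0, which gives local finiteness. *)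
have dm0 k : 0 < Num.min (r k) (ep k) by rewrite lt_min r0 ep0.
pose prof k (da : R * R) := [/\ 0 < da.1, da.1 <= Num.min (r k) (ep k), 0 < da.2 &
    forall tau (phi : E -> R) (x y : E), 0 < tau -> C2b phi -> r k < enorm (x - y) <= r k + da.1 ->
    (forall z : E, phi (x + z) - phi x <=
       log_barrier da.2 tau (r k) y (x + z) - log_barrier da.2 tau (r k) y x
       - ep k * \1_(eball y (r k)) (x + z)) ->
    drift_le (sigma := sigma) (lambda := lambda) (Lambda := Lambda) (mu := mu)
      phi x (C1 + C0 * enorm (grad phi x))].
have [da daP] : {da : nat -> R * R & forall k, prof k (da k)}.
  apply: choice => k; have [d0 [al [? ? ? P]]] := profile (ep k) (r k) _ (ep0 k) (r0 k) (dm0 k).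
  by exists (d0, al).
pose d0 k := (da k).1; pose al k := (da k).2.
have d00 k : 0 < d0 k by have [] := daP k.
have al0 k : 0 < al k by have [] := daP k.
have d0r k : d0 k <= r k by have [_ +] := daP k; rewrite le_min => /andP[].
have d0e k : d0 k <= ep k by have [_ +] := daP k; rewrite le_min => /andP[].
(* Solves [al k * ln (d0 k / tau k) = M + G]; the additional [G] compensates for [g y >= - G]. *)
pose tau k := d0 k / expR ((M + G) / al k).
have tau0 k : 0 < tau k by rewrite divr_gt0 // expR_gt0.
have GM : G <= M by rewrite lerDl ltW.
have height k : M + G <= al k * ln (1 + d0 k / tau k).
  rewrite -ler_pdivrMl // mulrC -[leLHS]expRK.
  have -> : d0 k / tau k = expR ((M + G) / al k).
    by rewrite /tau invf_div mulrCA divff ?mulr1 // gt_eqF.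
  by rewrite ler_ln ?posrE ?addr_gt0 ?expR_gt0 ?lerDr.
have ep_lt e : 0 < e -> exists N, forall k, (N <= k)%N -> ep k < e.
  move=> e0; exists (Num.truncn e^-1) => k Nk.
  rewrite /ep invf_plt ?posrE //; apply: lt_le_trans (truncnS_gt _) _.
  by rewrite ler_nat ltnS.
have d0_cvg e : 0 < e -> exists N, forall k, (N <= k)%N -> d0 k < e.
  by move=> /ep_lt [N NP]; exists N => k /NP; apply: le_lt_trans.
have extball x e : closure Omega x -> ~ Omega x -> 0 < e ->
    exists k y, [/\ ep k < e, enorm y <= Rd + 1, enorm (x - y) <= r k &
      forall z, Omega z -> r k <= enorm (z - y)].
  move=> clx nOx /ep_lt [k kP].
  have [rk0 rk1 rkO _] := rP k.
  have xb : (closure Omega `\` Omega°) x by split=> // /interior_subset.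
  have rint : 0 < r k <= rO by rewrite rk0.
  have [y _ yE] := ballO x xb (r k) rint.
  have [xy _] : (eclosed_ball y (r k) `&` closure Omega) x by rewrite yE.
  have {}xy : enorm (x - y) <= r k by exact: xy.
  exists k, y; split=> //; first exact: kP.
    have := closure_enorm_le Omega Rd ORd x clx; have := enorm_subl y x.
    by rewrite enorm_distC; lra.
  (* The closed ball meets the closure of [Omega] only at [x], so a point of [Omega] in the ball
     would be [x] itself. *)
  move=> z Oz; rewrite leNgt; apply/negP => zy; apply: nOx.
  have : (eclosed_ball y (r k) `&` closure Omega) z.
    by split; [exact: ltW|exact: subset_closure].
  by rewrite yE => /= <-.
have osc k x y : enorm y <= Rd + 1 -> enorm (x - y) <= 2 * r k -> `|g x - g y| <= ep k.
  by have [_ _ _ +] := rP k; apply.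
exists (barrier Omega g M Rd ep r al tau); split.
- exact: (barrier_continuous Omega g G M Rd ep r d0 al tau openO cg gG GM ep0 r0 d00 d0r
    al0 tau0 osc height d0_cvg extball).
- exists (M + G); split; first exact: num_real.
  move=> q qM x _; apply: (le_trans _ (ltW qM)).
  have := barrier_le Omega g G M Rd ep r d0 al tau gG GM ep0 d00 d0r al0 tau0 osc height x.
  have := barrier_ge Omega g G M Rd ep r d0 al tau gG GM ep0 d00 d0r al0 tau0 osc height x.
  have := gG x; have G0 : 0 <= G by exact: le_trans (gG 0).
  rewrite !ler_norml => /andP[h _] h1 h2; apply/andP; split; lra.
- exact: (barrier_ge Omega g G M Rd ep r d0 al tau gG GM ep0 d00 d0r al0 tau0 osc height).
- exact: barrier_out.
- apply: (barrier_touching Omega g G M Rd ep r d0 al tau openO ORd cg gG GM ep0 r0 d00 d0r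
    al0 tau0 osc height d0_cvg).
    move=> k phi x y; have [_ _ _] := daP k; apply; exact: tau0.
  move=> phi x C2phi phi_max phi_ann; apply: maxd => // z az.
  by have := phi_ann z az; rewrite /M; lra.
Qed.

End BarrierExistence.

(** * From drift bounds to the nonlocal operator *)

Section Ellipticity.
Context {R : realType} {n : nat}.
Local Notation E := 'rV[R]_n.+1.
Implicit Types (x : E) (phi : E -> R).

Lemma C2b_cst0 : C2b ((fun=> 0) : E -> R).
Proof.
split; last by exists 0; split=> // m m0 x _; rewrite normr0 ltW.
move=> i; split=> x _; first exact: derivable_cst.
exists setT; first exact: filterT.
apply/lipschitz_inP; exists 0 => y z _ _; rewrite mul0r.
by rewrite /partial !derive_cst subrr normr0.
Qed.

Lemma continuous_oppr (u : E -> R) : continuous u -> continuous (\- u).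
Proof.
move=> cu x; apply/continuous_at_enormP => e e0.
have /continuous_at_enormP/(_ e e0) [d d0 dP] := cu x.
by exists d => // y /dP; rewrite /= -opprD normrN.
Qed.

Lemma continuous_lsc (u : E -> R) : continuous u -> lsc u.
Proof.
move=> cu x a; rewrite /= lte_fin => au.
have ux : 0 < u x - a by rewrite subr_gt0.
have /continuous_at_enormP/(_ _ ux) [d d0 dP] := cu x.
exists [set y | enorm (y - x) < d]; first by apply/nbhs_enormP; exists d.
move=> y /= /dP; rewrite ltr_norml lte_fin => /andP[_]; lra.
Qed.

Context {sigma lambda Lambda mu C0 : R} {m : R -> R} {Omega : set E}.
Context {I : E -> R -> (E -> R) -> R}.
Hypothesis elliptic : forall (r s : R) x (delta : R) phi psi,
  Omega x -> 0 < delta -> admissible delta x phi -> admissible delta x psi ->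
  let err := C0 * enorm (grad (psi \- phi) x) + m `|r - s| in
  (Mminus sigma lambda Lambda mu (phi \- psi)%R x - err%:E <=
     (I x r psi - I x s phi)%:E <=
   Mplus sigma lambda Lambda mu (phi \- psi)%R x + err%:E)%E.
Local Notation drift_le := (@drift_le R n sigma lambda Lambda mu).

(** Ellipticity against the zero function at level 0. As [Mminus] is evaluated at [0 - phi],
    downward drift of [phi] makes the operator large, and the surplus [C0 |grad phi|] in the drift
    cancels the gradient error. *)
Lemma operator_ge phi x (r b : R) : Omega x -> C2b phi ->
  drift_le phi x (b + C0 * enorm (grad phi x)) ->
  I x 0 (fun=> 0) + b - m `|r| <= I x r phi.
Proof.
move=> Ox C2phi drift.
have [h _] := andP (elliptic r 0 x 1 (fun=> 0) phi Ox ltr01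
  (C2b_admissible 1 x _ C2b_cst0) (C2b_admissible 1 x phi C2phi)).
have dphi i : derivable phi x 'e_i by have [/(_ i) [+ _] _] := C2phi; apply.
have E1 : phi \- (fun=> 0) = phi by apply/funext => y /=; rewrite subr0.
have E2 : (fun=> 0) \- phi = \- phi by apply/funext => y /=; rewrite sub0r.
have Mle : ((b + C0 * enorm (grad phi x))%:E <=
    Mminus sigma lambda Lambda mu ((fun=> 0) \- phi)%R x)%E.
  apply: le_ereal_inf_tmp => _ [K KK <-]; rewrite /linear_operator E2.
  under eq_integral do rewrite incrementN //.
  by have [] := drift K KK.
move: h; rewrite E1 subr0 => h.
have := le_trans (leeB Mle (lexx _)) h.
by rewrite -EFinB lee_fin; lra.
Qed.

Lemma operator_le phi x (r b : R) : Omega x -> C2b phi ->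
  drift_le (\- phi) x (b + C0 * enorm (grad phi x)) ->
  I x r phi <= I x 0 (fun=> 0) - b + m `|r|.
Proof.
move=> Ox C2phi drift.
have [_ h] := andP (elliptic r 0 x 1 (fun=> 0) phi Ox ltr01
  (C2b_admissible 1 x _ C2b_cst0) (C2b_admissible 1 x phi C2phi)).
have E1 : phi \- (fun=> 0) = phi by apply/funext => y /=; rewrite subr0.
have E2 : (fun=> 0) \- phi = \- phi by apply/funext => y /=; rewrite sub0r.
have Mle : (Mplus sigma lambda Lambda mu ((fun=> 0) \- phi)%R x <=
    (- (b + C0 * enorm (grad phi x)))%:E)%E.
  apply: ge_ereal_sup => _ [K KK <-]; rewrite /linear_operator E2.
  by have [] := drift K KK.
move: h; rewrite E1 subr0 => h.
have := le_trans h (leeD Mle (lexx _)).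
by rewrite -EFinD lee_fin; lra.
Qed.

End Ellipticity.

Theorem theorem5p5 (R : realType) (n : nat) (Omega : set 'rV[R]_n.+1)
    (sigma : R) (g : 'rV[R]_n.+1 -> R)
    (I : 'rV[R]_n.+1 -> R -> ('rV[R]_n.+1 -> R) -> R)
    (domain_Omega : domain Omega) (bounded_Omega : bounded_set Omega)
    (ball_Omega : uniform_exterior_ball Omega)
    (sigma_gt0 : 0 < sigma) (sigma_lt2 : sigma < 2)
    (bounded_g : bounded_fun g) (continuous_g : continuous g)
    (elliptic_I : uniformly_elliptic sigma Omega I)
    (continuity_I : operator_continuity Omega I)
    (monotonicity_I : operator_monotonicity Omega I)
    (bounded_I : [bounded I x 0 (fun=> 0) | x in Omega]) :
  exists ubar ulow : 'rV[R]_n.+1 -> R,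
    [/\ continuous ubar, Dirichlet_supersolution Omega I g ubar,
        continuous ulow, Dirichlet_subsolution Omega I g ulow
      & forall x, (~` Omega) x -> ubar x = g x /\ ulow x = g x].
Proof.
have [openO _ _] := domain_Omega.
have [lambda [Lambda [mu [m [C0 [[l0 lL mu0] [m_ge0 m_mono m00 _] C00 C0s elliptic]]]]]] := elliptic_I.
have [G gG] : exists G : R, forall x, `|g x| <= G.
  have [G [_ GP]] := bounded_g; exists (G + 1) => x.
  by apply: (GP (G + 1)) => //; rewrite ltrDl.
have [B IB] : exists B : R, forall x, Omega x -> `|I x 0 (fun=> 0)| <= B.
  have [B [_ BP]] := bounded_I; exists (B + 1) => x Ox.
  by apply: (BP (B + 1)) => //; rewrite ltrDl.
have G0 : 0 <= G by exact: le_trans (gG 0).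
(* [B] bounds the operator at the zero function, and [m G] is the cost of passing from level 0 to
   level [- G] or [G]. *)
pose C1 : R := `|B| + m G.
have C10 : 0 <= C1 by rewrite addr_ge0 // m_ge0.
have [u [cu bu gu uO u_touch]] := @barrier_exists R n sigma lambda Lambda mu
  sigma_gt0 sigma_lt2 l0 lL mu0 Omega g G C0 C1 openO bounded_Omega ball_Omega
  continuous_g gG C00 C0s C10.
have cNg : continuous (\- g) by exact: continuous_oppr.
have NgG x : `|(\- g) x| <= G by rewrite normrN.
have [w [cw bw gw wO w_touch]] := @barrier_exists R n sigma lambda Lambda mu
  sigma_gt0 sigma_lt2 l0 lL mu0 Omega (\- g) G C0 C1 openO bounded_Omega ball_Omega
  cNg NgG C00 C0s C10.
have cNw : continuous (\- w) by exact: continuous_oppr.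
have adm (x : 'rV[R]_n.+1) (phi : 'rV[R]_n.+1 -> R) : C2b phi -> admissible 1 x phi.
  exact: C2b_admissible.
exists u, (\- w); split.
- exact: cu.
- split; last by move=> x _; exact: gu.
  split; [exact: bu|exact: continuous_lsc|].
  move=> x phi Ox C2phi touch.
  (* The size of [u] depends on [C1], so [m] cannot be evaluated at [u x]. Monotonicity lowers the
     level to [- G], which is known in advance; for the subsolution it raises the level to [G]. *)
  have Gu : - G <= u x.
    by apply: le_trans (gu x); have := gG x; rewrite ler_norml => /andP[].
  have mono := monotonicity_I 1 x phi _ _ ltr01 Ox (adm x phi C2phi) Gu.
  apply: le_trans _ mono.
  have := operator_ge elliptic phi x (- G) C1 Ox C2phi (u_touch x phi Ox C2phi touch).
  have := IB x Ox; have := ler_norm B.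
  rewrite normrN (ger0_norm G0) ler_norml /C1 => h1 /andP[h2 _]; lra.
- exact: cNw.
- split; last first.
    by move=> x xO; rewrite /= wO // opprK.
  split.
  + by have [q [qr qP]] := bw; exists q; split=> // t qt x xT; rewrite /= normrN; exact: qP.
  + rewrite /usc (_ : \- (\- w) = w); first exact: continuous_lsc.
    by apply/funext => x /=; rewrite opprK.
  + move=> x phi Ox C2phi touch.
    have Gw : (\- w) x <= G.
      by rewrite /= lerNl; apply: le_trans (gw x); have := gG x; rewrite /= ler_norml lerN2 => /andP[].
    have mono := monotonicity_I 1 x phi _ _ ltr01 Ox (adm x phi C2phi) Gw.
    apply: le_trans mono _.
    have dphi i : derivable phi x 'e_i by have [/(_ i) [+ _] _] := C2phi; apply.
    have touchN y : w x - (\- phi) x <= w y - (\- phi) y.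
      by have := touch y; rewrite /=; lra.
    have := w_touch x (\- phi) Ox (C2bN phi C2phi) touchN.
    rewrite gradN // enormN => drift.
    have := operator_le elliptic phi x G C1 Ox C2phi drift.
    have := IB x Ox; have := ler_norm B.
    rewrite (ger0_norm G0) ler_norml /C1 => h1 /andP[_ h2]; lra.
- by move=> x xO; split; [exact: uO|rewrite /= wO // opprK].
Qed.
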